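(* Let $k$ be a field, let $R=k[x_1,\ldots,x_n]$, and let $\Delta$ be a simplicial tree (or, more generally, a simplicial forest) whose vertices are among $x_1,\ldots,x_n$. Let $\mathcal{F}(\Delta)\subseteq R$ be the facet ideal of $\Delta$. Then $\mathcal{F}(\Delta)$ is sequentially Cohen-Macaulay, i.e. the $R$-module $R/\mathcal{F}(\Delta)$ is sequentially Cohen-Macaulay.
   Context: A simplicial complex $\Delta$ is a collection of subsets (faces) of a finite nonempty vertex set, closed under taking subsets and containing every singleton of a vertex; its facets are its maximal faces. We write $\Delta=\langle F_1,\ldots,F_q\rangle$ for the complex with facets $F_1,\ldots,F_q$. A subcollection of $\Delta$ is a simplicial complex whose set of facets is a subset of the set of facets of $\Delta$. Vertices are identified with variables. The facet ideal $\mathcal{F}(\Delta)\subseteq R$ is the ideal generated by the square-free monomials $\prod_{x\in F}x$, where $F$ ranges over the facets of $\Delta$. $\Delta$ is connected if for any two facets $F,F'$ there is a sequence of facets starting at $F$ and ending at $F'$ in which consecutive facets have nonempty intersection. A facet $F$ of $\Delta$ is a leaf if either $F$ is the only facet of $\Delta$, or there is a facet $G\neq F$ of $\Delta$ such that $F\cap F'\subseteq G$ for every facet $F'\ne F$ of $\Delta$. $\Delta$ is a forest if every nonempty subcollection of $\Delta$ has a leaf; a tree is a connected forest. A finitely generated $\mathbb{Z}$-graded module $M$ over a finitely generated $\mathbb{N}$-graded $k$-algebra $R$ with $R_0=k$ is sequentially Cohen-Macaulay if there is a finite filtration $0=M_0\subseteq M_1\subseteq\cdots\subseteq M_r=M$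 by graded submodules such that (a) each quotient $M_i/M_{i-1}$ is Cohen-Macaulay, and (b) $\dim(M_1/M_0)<\dim(M_2/M_1)<\cdots<\dim(M_r/M_{r-1})$, where $\dim$ is Krull dimension. Here $R=k[x_1,\ldots,x_n]$ has the standard grading $\deg x_i=1$. *)

(* Defs.v *)
From HB Require Import structures.
From mathcomp Require Import all_boot all_order all_algebra ring_quotient.
From mathcomp Require Import mpoly.
From mathcomp Require boolp.

Set Implicit Arguments.
Unset Strict Implicit.
Unset Printing Implicit Defensive.

Import GRing.Theory.
Local Open Scope ring_scope.
Local Open Scope quotient_scope.

(** A submodule of [M] is a [submodClosed M], i.e. a boolean predicate; since
    [boolp.asbool] makes every predicate boolean, this is no restriction. *)

Section QuotientModule.
Variables (R : pzRingType) (M : lmodType R) (N : submodClosed M).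

(** A [submodClosed] predicate is not syntactically an opposite-closed one. *)
Definition submod_zmod : {pred M} := N.
HB.instance Definition _ :=
  GRing.isZmodClosed.Build M submod_zmod
    (GRing.submod_closedB (submodClosedP N)).

Definition quotmod : Type := Quotient.quot submod_zmod.
HB.instance Definition _ := GRing.Zmodule.on quotmod.

Definition quotmod_pi (x : M) : quotmod := \pi_(Quotient.quot submod_zmod) x.

Lemma quotmod_pi_eq (x y : M) :
  (quotmod_pi x == quotmod_pi y) = (x - y \in N).
Proof. exact/esym/(Quotient.idealrBE submod_zmod x y). Qed.

Lemma quotmod_piD : {morph quotmod_pi : x y / x + y}.
Proof. by move=> x y; rewrite /quotmod_pi !piE. Qed.

Lemma quotmod_pi0 : quotmod_pi 0 = 0.
Proof. by rewrite /quotmod_pi !piE. Qed.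

Lemma quotmod_piP (u : quotmod) : exists x : M, u = quotmod_pi x.
Proof. by exists (repr (u : Quotient.quot submod_zmod)); rewrite /quotmod_pi reprK. Qed.

Lemma quotmod_pi_eq0 (x : M) : (quotmod_pi x == 0) = (x \in N).
Proof. by rewrite -quotmod_pi0 quotmod_pi_eq subr0. Qed.

Definition quotmod_scale (a : R) (u : quotmod) : quotmod :=
  quotmod_pi (a *: repr (u : Quotient.quot submod_zmod)).

Lemma quotmod_piZ (a : R) (x : M) :
  quotmod_scale a (quotmod_pi x) = quotmod_pi (a *: x).
Proof.
apply/eqP; rewrite quotmod_pi_eq -scalerBr rpredZ // -quotmod_pi_eq.
by rewrite /quotmod_pi reprK.
Qed.

Fact quotmod_scaleA (a b : R) (u : quotmod) :
  quotmod_scale a (quotmod_scale b u) = quotmod_scale (a * b) u.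
Proof. by have [x ->] := quotmod_piP u; rewrite !quotmod_piZ scalerA. Qed.

Fact quotmod_scale1 : left_id 1 quotmod_scale.
Proof.
by move=> u; have [x ->] := quotmod_piP u; rewrite quotmod_piZ scale1r.
Qed.

Fact quotmod_scaleDr : right_distributive quotmod_scale +%R.
Proof.
move=> a u v; have [x ->] := quotmod_piP u; have [y ->] := quotmod_piP v.
by rewrite -quotmod_piD !quotmod_piZ -quotmod_piD scalerDr.
Qed.

Fact quotmod_scaleDl (u : quotmod) : {morph quotmod_scale^~ u : a b / a + b}.
Proof.
move=> a b; have [x ->] := quotmod_piP u.
by rewrite !quotmod_piZ -quotmod_piD scalerDl.
Qed.

HB.instance Definition _ := GRing.Zmodule_isLmodule.Build R quotmod
  quotmod_scaleA quotmod_scale1 quotmod_scaleDr quotmod_scaleDl.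

Fact quotmod_pi_is_linear : linear quotmod_pi.
Proof. by move=> a x y; rewrite quotmod_piD -quotmod_piZ. Qed.

HB.instance Definition _ :=
  GRing.isLinear.Build R M quotmod _ quotmod_pi quotmod_pi_is_linear.

End QuotientModule.

Section Submodule.
Variables (R : pzRingType) (M : lmodType R) (P : submodClosed M).

Record submod := Submod { submod_val :> M; _ : submod_val \in P }.
HB.instance Definition _ := [isSub for submod_val].
HB.instance Definition _ := [Choice of submod by <:].
HB.instance Definition _ := [SubChoice_isSubLmodule of submod by <:].

Definition submod_pred (N : submodClosed M) : {pred submod} :=
  [pred x : submod | val x \in N].

Fact submod_pred_closed (N : submodClosed M) : submod_closed (submod_pred N).
Proof.
split=> [|a x y]; first exact: (rpred0 N).
move=> xN yN; have axyN : a *: val x + val y \in N by rewrite rpredD ?rpredZ.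
by rewrite inE linearP.
Qed.

HB.instance Definition _ (N : submodClosed M) :=
  GRing.isSubmodClosed.Build R submod (submod_pred N) (submod_pred_closed N).

End Submodule.

(** [subquot P N] is the module [P / (P :&: N)], that is [P / N] when [N] is
    contained in [P]. *)
Definition subquot (R : pzRingType) (M : lmodType R) (P N : submodClosed M) :
  lmodType R := quotmod (@submod_pred R M P N).

Section Dimension.
Variables (R : comNzRingType) (M : lmodType R).

Definition annihilates (a : R) : Prop := forall m : M, a *: m = 0.

(** [P 0], ..., [P d] is a strict chain of primes containing [Ann M]. *)
Definition prime_chain (d : nat) (P : nat -> prime_idealr R) : Prop :=
  [/\ forall i a, (i <= d)%N -> annihilates a -> a \in P i,
      forall i, (i < d)%N -> {subset P i <= P i.+1}
    & forall i, (i < d)%N -> exists2 a, a \in P i.+1 & a \notin P i].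

(** The Krull dimension of [M] is that of [R / Ann M]; the zero module, whose
    dimension is by convention negative, has no dimension in this sense. *)
Definition has_krull_dim (d : nat) : Prop :=
  (exists P, prime_chain d P) /\
  (forall e P, prime_chain e P -> (e <= d)%N).

(** Membership in the submodule [(x_1, ..., x_s) M]. *)
Definition in_seqmul (xs : seq R) (m : M) : Prop :=
  exists c : nat -> M, m = \sum_(j < size xs) xs`_j *: c j.

Definition regular_seq (xs : seq R) : Prop :=
  (forall i (m : M), (i < size xs)%N ->
     in_seqmul (take i xs) (xs`_i *: m) -> in_seqmul (take i xs) m) /\
  (exists m : M, ~ in_seqmul xs m).

(** Sequences in [J] are not required to be homogeneous: for the irrelevant
    ideal and a finitely generated graded module, the maximal length of a
    homogeneous regular sequence is the same. *)
Definition has_depth (J : {pred R}) (d : nat) : Prop :=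
  (exists xs, [/\ size xs = d, {subset xs <= J} & regular_seq xs]) /\
  (forall xs, {subset xs <= J} -> regular_seq xs -> (size xs <= d)%N).

End Dimension.

Definition irrelevant (k : fieldType) (n : nat) : {pred {mpoly k[n]}} :=
  [pred p : {mpoly k[n]} | p@_(0%MM) == 0].

(** The zero module is not counted as Cohen-Macaulay; in a filtration as in
    [sequentially_CM] a zero quotient could only be the first one, and can then
    be dropped. *)
Definition cohen_macaulay (k : fieldType) (n : nat)
    (M : lmodType {mpoly k[n]}) : Prop :=
  exists d, has_krull_dim M d /\ has_depth M (@irrelevant k n) d.

(** [N] contains [c d] for all [d] as soon as it contains their sum: for [N = 0]
    the sum of the [gr d] is direct, and for a submodule [N] of a graded module
    it says that [N] contains the homogeneous components of its elements. *)
Definition homog_indep (R : pzRingType) (M : lmodType R)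
    (gr : int -> M -> Prop) (N : {pred M}) : Prop :=
  forall (s : seq int) (c : int -> M), uniq s -> (forall d, gr d (c d)) ->
    \sum_(d <- s) c d \in N -> forall d, d \in s -> c d \in N.

Record grmodule (k : fieldType) (n : nat) := GrModule {
  gr_sort :> lmodType {mpoly k[n]};
  gr_comp : int -> gr_sort -> Prop;
  gr_comp0 : forall d, gr_comp d 0;
  gr_compB : forall d x y, gr_comp d x -> gr_comp d y -> gr_comp d (x - y);
  gr_compZ : forall (i : nat) d (p : {mpoly k[n]}) x,
    p \is i.-homog -> gr_comp d x -> gr_comp (i%:Z + d) (p *: x);
  gr_span : forall x, exists (s : seq int) (c : int -> gr_sort),
    [/\ uniq s, forall d, gr_comp d (c d) & x = \sum_(d <- s) c d];
  gr_direct : homog_indep gr_comp [pred x | x == 0];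
  gr_fingen : exists g : seq gr_sort, forall x,
    exists a : nat -> {mpoly k[n]}, x = \sum_(j < size g) a j *: g`_j
}.

Definition graded_submod (k : fieldType) (n : nat) (M : grmodule k n)
    (N : submodClosed M) : Prop := homog_indep (@gr_comp k n M) N.

Definition sequentially_CM (k : fieldType) (n : nat) (M : grmodule k n) : Prop :=
  exists (r : nat) (N : nat -> submodClosed M),
    [/\ (N 0 =i [pred x | x == 0]) /\ (N r =i predT),
        forall i, (i <= r)%N -> graded_submod (N i),
        forall i, (i < r)%N -> {subset N i <= N i.+1},
        forall i, (i < r)%N -> cohen_macaulay (subquot (N i.+1) (N i))
      & forall i d e, (i.+1 < r)%N ->
          has_krull_dim (subquot (N i.+1) (N i)) d ->
          has_krull_dim (subquot (N i.+2) (N i.+1)) e -> (d < e)%N].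

Section PolynomialModule.
Variables (k : fieldType) (n : nat).
Local Notation R := {mpoly k[n]}.

Definition poly_comp (d : int) (p : R^o) : Prop :=
  if d is Posz i then (p : R) \is i.-homog else p = 0.

Fact poly_comp0 d : poly_comp d 0.
Proof. by case: d => i //=; apply: rpred0. Qed.

Fact poly_compB d (x y : R^o) :
  poly_comp d x -> poly_comp d y -> poly_comp d (x - y).
Proof.
case: d => i /=; first exact: rpredB.
by move=> -> ->; rewrite subrr.
Qed.

Fact poly_compZ (i : nat) d (p : R) (x : R^o) :
  p \is i.-homog -> poly_comp d x -> poly_comp (i%:Z + d) (p *: x).
Proof.
case: d => j hp /=; first exact: dhomogM.
by move=> ->; rewrite scaler0; apply: poly_comp0.
Qed.

Fact poly_span (x : R^o) : exists (s : seq int) (c : int -> R^o),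
  [/\ uniq s, forall d, poly_comp d (c d) & x = \sum_(d <- s) c d].
Proof.
exists [seq Posz i | i <- iota 0 (msize (x : R))].
exists (fun d : int => if d is Posz i then pihomog mdeg i (x : R) else 0).
split.
- by rewrite map_inj_uniq ?iota_uniq // => i j [].
- by case=> i //=; apply: pihomogP.
- rewrite big_map -{1}[msize _]subn0 -/(index_iota _ _) big_mkord.
  exact: (pihomog_partitionE (leqnn _)).
Qed.

Lemma pihomog_sum (s : seq int) (c : int -> R^o) (i : nat) :
  uniq s -> (forall d, poly_comp d (c d)) -> Posz i \in s ->
  pihomog mdeg i (\sum_(d <- s) c d : R) = c (Posz i).
Proof.
move=> us hc si; rewrite raddf_sum (bigD1_seq (Posz i)) //=.
rewrite pihomog_dE; last exact: (hc (Posz i)).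
rewrite big1 ?addr0 // => -[j|j] ne; last first.
  by rewrite (hc (Negz j) : c (Negz j) = 0) pihomog0.
by apply: (@pihomog_ne0 _ _ _ j); last exact: (hc (Posz j)).
Qed.

Lemma poly_indep (N : {pred R^o}) : 0 \in N ->
  (forall i p, p \in N -> pihomog mdeg i (p : R) \in N) ->
  homog_indep poly_comp N.
Proof.
move=> N0 Npi s c us hc sN [i|i] si; last by rewrite (hc (Negz i) : c _ = 0).
by rewrite -(pihomog_sum us hc si); apply: Npi.
Qed.

Fact poly_direct : homog_indep poly_comp [pred x | x == 0].
Proof.
apply: poly_indep => [|i p]; rewrite !inE //.
by move=> /eqP ->; rewrite pihomog0.
Qed.

Fact poly_fingen : exists g : seq R^o, forall x : R^o,
  exists a : nat -> R, x = \sum_(j < size g) a j *: g`_j.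
Proof.
exists [:: 1] => x; exists (fun=> x).
by rewrite big_ord1 /= [_ *: _]mulr1.
Qed.

Definition poly_grmodule : grmodule k n :=
  GrModule poly_comp0 poly_compB poly_compZ poly_span poly_direct poly_fingen.

End PolynomialModule.

Section QuotientGrading.
Variables (k : fieldType) (n : nat) (M : grmodule k n) (N : submodClosed M).
Hypothesis grN : graded_submod N.
Local Notation pi := (@quotmod_pi _ M N).

Definition quot_comp (d : int) (u : quotmod N) : Prop :=
  exists2 x : M, gr_comp d x & u = pi x.

Fact quot_comp0 d : quot_comp d 0.
Proof. by exists 0; [exact: gr_comp0 | rewrite linear0]. Qed.

Fact quot_compB d (u v : quotmod N) :
  quot_comp d u -> quot_comp d v -> quot_comp d (u - v).
Proof.
move=> [x hx ->] [y hy ->]; exists (x - y); first exact: gr_compB.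
by rewrite linearB.
Qed.

Fact quot_compZ (i : nat) d (p : {mpoly k[n]}) (u : quotmod N) :
  p \is i.-homog -> quot_comp d u -> quot_comp (i%:Z + d) (p *: u).
Proof.
move=> hp [x hx ->]; exists (p *: x); first exact: gr_compZ.
by rewrite linearZ.
Qed.

Fact quot_span (u : quotmod N) : exists (s : seq int) (c : int -> quotmod N),
  [/\ uniq s, forall d, quot_comp d (c d) & u = \sum_(d <- s) c d].
Proof.
have [x ->] := quotmod_piP u; have [s [c [us hc ->]]] := gr_span x.
exists s, (pi \o c); split=> // [d|]; first by exists (c d).
by rewrite linear_sum.
Qed.

Fact quot_direct : homog_indep quot_comp [pred x | x == 0].
Proof.
move=> s c us hc.
have ex d : exists x : M, gr_comp d x /\ c d = pi x.
  by have [x hx e] := hc d; exists x.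
have [y hy] := boolp.choice ex.
have -> : \sum_(d <- s) c d = pi (\sum_(d <- s) y d).
  by rewrite linear_sum; apply: eq_bigr => d _; rewrite (hy d).2.
rewrite [_ \in _]quotmod_pi_eq0 => sN d sd.
rewrite (hy d).2 [_ \in _]quotmod_pi_eq0.
by apply: grN sd => // e; have [] := hy e.
Qed.

Fact quot_fingen : exists g : seq (quotmod N), forall u : quotmod N,
  exists a : nat -> {mpoly k[n]}, u = \sum_(j < size g) a j *: g`_j.
Proof.
have [g hg] := gr_fingen M; exists (map pi g) => u.
have [x ->] := quotmod_piP u; have [a ->] := hg x; exists a.
rewrite linear_sum size_map; apply: eq_bigr => j _.
by rewrite linearZ (nth_map 0).
Qed.

Definition quot_grmodule : grmodule k n :=
  GrModule quot_comp0 quot_compB quot_compZ quot_span quot_direct quot_fingen.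

End QuotientGrading.

Section GeneratedIdeal.
Variables (R : comNzRingType) (s : seq R).

(** Ideals of [R] are the submodules of the regular module [R^o]. *)
Definition ideal_gen : {pred R^o} := fun p : R =>
  boolp.asbool (exists a : nat -> R, p = \sum_(j < size s) a j * s`_j).

Lemma ideal_genP (p : R) :
  reflect (exists a : nat -> R, p = \sum_(j < size s) a j * s`_j)
          (p \in ideal_gen).
Proof. exact: boolp.asboolP. Qed.

Fact ideal_gen_closed : submod_closed ideal_gen.
Proof.
split=> [|b p q].
  by apply/ideal_genP; exists (fun=> 0); rewrite big1 // => j _; rewrite mul0r.
move=> /ideal_genP[u ->] /ideal_genP[v ->]; apply/ideal_genP.
exists (fun j => b * u j + v j).
rewrite [_ *: _]mulr_sumr -big_split; apply: eq_bigr => j _ /=.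
by rewrite mulrDl mulrA.
Qed.

HB.instance Definition _ :=
  GRing.isSubmodClosed.Build R R^o ideal_gen ideal_gen_closed.

End GeneratedIdeal.

Section HomogeneousIdeal.
Variables (k : fieldType) (n : nat).
Local Notation R := {mpoly k[n]}.

Lemma pihomogMr (e d : nat) (a g : R) : g \is d.-homog ->
  pihomog mdeg e (a * g) =
    if (d <= e)%N then pihomog mdeg (e - d) a * g else 0.
Proof.
move=> hg; rewrite {1}(pihomog_partitionE (leqnn (msize a))).
rewrite mulr_suml raddf_sum /=.
have hom (i : nat) : pihomog mdeg i a * g \is (i + d).-homog.
  by apply: dhomogM => //; apply: pihomogP.
case: leqP => [le_de|lt_ed]; last first.
  apply: big1 => i _; apply: pihomog_ne0 (hom i).
  by rewrite neq_ltn (leq_trans lt_ed) ?orbT // leq_addl.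
have [lt|ge] := ltnP (e - d) (msize a).
  rewrite (bigD1 (Ordinal lt)) //= big1 ?addr0 => [|i ne].
    by rewrite pihomog_dE // -{2}(subnK le_de).
  apply: pihomog_ne0 (hom i); apply: contraNneq ne => e_id.
  by apply/eqP/val_inj; rewrite /= -e_id addnK.
rewrite big1 => [|i _]; last first.
  apply: pihomog_ne0 (hom i); rewrite neq_ltn addnC -ltn_subRL.
  by rewrite (leq_trans (ltn_ord i) ge).
suff -> : pihomog mdeg (e - d) a = 0 by rewrite mul0r.
rewrite (pihomog_partitionE (leqnn (msize a))) raddf_sum big1 // => i _.
apply: (@pihomog_ne0 _ _ _ i); last exact: pihomogP.
by rewrite neq_ltn (leq_trans (ltn_ord i) ge).
Qed.

Lemma graded_ideal_gen (s : seq R) :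
  (forall g, g \in s -> exists d, g \is d.-homog) ->
  @graded_submod k n (poly_grmodule k n) (ideal_gen s).
Proof.
move=> hs; apply: poly_indep => [|e p]; first exact: rpred0.
move=> /ideal_genP[a ->]; rewrite raddf_sum.
apply: (@rpred_sum _ (ideal_gen s : submodClosed R^o)) => j _ /=.
have [d hd] := hs _ (mem_nth 0 (ltn_ord j)).
rewrite (pihomogMr _ _ hd); case: ifP => _; last exact: rpred0.
apply: (@rpredZ _ _ (ideal_gen s : submodClosed R^o)).
apply/ideal_genP; exists (fun i : nat => (i == j :> nat)%:R).
rewrite (bigD1 j) //= eqxx mul1r big1 ?addr0 // => i ne.
by rewrite val_eqE (negbTE ne) mul0r.
Qed.

End HomogeneousIdeal.

Record complex (T : finType) := Complex {
  vertices : {set T};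
  faces : {set {set T}};
  vertices_neq0 : vertices != set0;
  face_sub : forall F, F \in faces -> F \subset vertices;
  face_down : forall F G : {set T}, F \in faces -> G \subset F -> G \in faces;
  face_vertex : forall v, v \in vertices -> [set v] \in faces
}.

Section Forests.
Variable T : finType.
Implicit Types (D E : complex T) (F G : {set T}).

Definition facets D : {set {set T}} :=
  [set F | maxset (fun G => G \in faces D) F].

Definition subcollection E D : Prop := facets E \subset facets D.

Definition is_leaf D F : Prop :=
  F \in facets D /\
  (facets D = [set F] \/
   exists G, [/\ G \in facets D, G != F &
     forall F', F' \in facets D -> F' != F -> F :&: F' \subset G]).

Definition connected D : Prop :=
  forall F F', F \in facets D -> F' \in facets D ->
    exists p : seq {set T},
      [/\ {subset p <= facets D},
          path (fun A B : {set T} => A :&: B != set0) F p & last F p = F'].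

(** Every [complex] has a vertex, so every subcollection is nonempty. *)
Definition simplicial_forest D : Prop :=
  forall E, subcollection E D -> exists F, is_leaf E F.

Definition simplicial_tree D : Prop := simplicial_forest D /\ connected D.

End Forests.

Section FacetIdeal.
Variables (k : fieldType) (n : nat) (D : complex 'I_n).

Definition facet_gens : seq {mpoly k[n]} :=
  [seq \prod_(i in F) 'X_i | F : {set 'I_n} <- enum (facets D)].

Definition facet_ideal : submodClosed {mpoly k[n]}^o := ideal_gen facet_gens.

Fact facet_gens_homog (g : {mpoly k[n]}) :
  g \in facet_gens -> exists d, g \is d.-homog.
Proof.
move=> /mapP[F _ ->]; exists (\sum_(i in F) 1)%N.
apply: (big_ind2 (fun (p : {mpoly k[n]}) d => p \is d.-homog)).
- exact: dhomog1.
- by move=> p d q e; apply: dhomogM.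
- by move=> i _; rewrite dhomogX /= mdeg1.
Qed.

Definition facet_quotient : grmodule k n :=
  @quot_grmodule k n (poly_grmodule k n) facet_ideal
    (graded_ideal_gen facet_gens_homog).

End FacetIdeal.

Arguments facet_ideal k [n] D.
Arguments facet_quotient k [n] D.

(* Main.v *)
From HB Require Import structures.
Require Import Defs.
From mathcomp Require Import all_boot all_order all_algebra ring_quotient.
From mathcomp Require Import mpoly.
From mathcomp Require boolp classical_sets.

Set Implicit Arguments.
Unset Strict Implicit.
Unset Printing Implicit Defensive.

Import GRing.Theory.
Local Open Scope ring_scope.

(** Let [phi] be the set of maximal independent sets of the facets of the forest,
    that is, the complements of the minimal vertex covers. The facet ideal is the
    intersection, over [F] in [phi], of the primes [P_F] generated by the variables
    outside [F]. The theorem rests on the fact that [phi] can be shelled, and that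
    the shelling can be sorted by decreasing size.

    Shelling. A leaf of a forest has a vertex lying in no other facet. After
    restriction to a smaller vertex set the leaf may be contained in its joint, but
    then the joint is redundant as a non-face. A free vertex [x] in [E]
    splits the maximal independent sets into those containing [x] and those
    containing the rest of [E]; both kinds are shellable by induction and the two
    shellings can be concatenated ([shelling_free_vertex], [leafy_shelling]). By
    the lemma of Bjoerner and Wachs the facets of a shelling can be sorted by
    decreasing size without changing the smallest new faces ([rearrangement]).

    From the sorted shelling to the module. Let [J_i] be the intersection of the
    [P_F] with [#|F|] among all but the [i] smallest sizes. The layers
    [J_(i+1) / J_i] then have filtrations in which every quotient is some [R/P_F]
    with [#|F|] equal to one fixed number [d], the generator being the square-free
    monomial of the smallest new face of [F] ([layer_pure_filt]).

    Such a module [M] is Cohen-Macaulay of dimension [d]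
    ([pure_filt_cohen_macaulay]). The elementary symmetric polynomials of degrees
    [d], ..., [1] form a regular sequence: modulo [P_F] the one of degree [d] is the
    product of the variables of [F], hence regular, and the quotient by this
    product is filtered by coordinate quotients of dimension [d - 1]
    ([pure_filt_mesym]). Conversely a regular sequence of any length yields a chain
    of primes of the same length above the annihilator ([prime_chain_of_regular]),
    and such chains have length at most [d], because a prime containing the
    annihilator contains some [P_F], and more than [#|F|] polynomials are
    algebraically dependent modulo [P_F] while elements picked along a chain of
    primes are independent ([coord_prime_dim]). So depth and dimension are both
    [d]. *)

(** * Prime ideals and regular sequences *)

Section PrimeExistence.
Variables (R : comNzRingType) (Q : R -> Prop).
Hypotheses (Q0 : Q 0) (QD : forall a u v, Q u -> Q v -> Q (a * u + v)).
Hypotheses (Q1 : ~ Q 1) (QM : forall u v, Q (u * v) -> Q u \/ Q v).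

Definition prime_of_pred : {pred R} := fun u => boolp.asbool (Q u).

Fact prime_of_pred_idealr : idealr_closed prime_of_pred.
Proof.
split=> [||a u v /boolp.asboolP qu /boolp.asboolP qv]; apply/boolp.asboolP=> //.
exact: QD.
Qed.

Fact prime_of_pred_prime : prime_idealr_closed prime_of_pred.
Proof.
by move=> u v /boolp.asboolP /QM[] q; apply/orP; [left|right]; apply/boolp.asboolP.
Qed.

HB.instance Definition _ := isIdealr.Build R prime_of_pred prime_of_pred_idealr.
HB.instance Definition _ :=
  isPrimeIdealrClosed.Build R prime_of_pred prime_of_pred_prime.

Lemma prime_of_predP : exists P : prime_idealr R, forall u, u \in P <-> Q u.
Proof. by exists prime_of_pred => u; split=> /boolp.asboolP. Qed.

End PrimeExistence.

(** Krull's theorem: an ideal maximal among those containing [A] and missing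
    [S], which exists by Zorn's lemma, is prime. *)
Lemma prime_avoiding (R : comNzRingType) (A S : R -> Prop) :
  A 0 -> (forall a u v, A u -> A v -> A (a * u + v)) ->
  S 1 -> (forall s t, S s -> S t -> S (s * t)) ->
  (forall a, A a -> ~ S a) ->
  exists P : prime_idealr R,
    (forall a, A a -> a \in P) /\ (forall s, S s -> s \notin P).
Proof.
move=> A0 AD S1 SM AS.
pose good (X : R -> Prop) := [/\ forall a, A a -> X a,
  forall a u v, X u -> X v -> X (a * u + v) & forall a, X a -> ~ S a].
(* Empty sets are admitted so that the union of the empty chain is allowed. *)
pose P (X : R -> Prop) := (forall x, ~ X x) \/ good X.
have [|Y [PY maxY]] := @classical_sets.Zorn_bigcup R P.
  move=> F FP tot.
  have [[X [FX nX]]|none] := boolp.pselect (exists X, F X /\ exists x, X x).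
    have gX Z z : F Z -> Z z -> good Z by move=> /FP[/(_ z)|].
    have [x Xx] := nX; right; split=> [a Aa|a u v [U FU Uu] [V FV Vv]|a [U FU Ua]].
    - by exists X => //; have [h _ _] := gX _ _ FX Xx; apply: h.
    - have [UV|VU] := tot _ _ FU FV.
        by exists V => //; have [_ h _] := gX _ _ FV Vv; apply/h/Vv/UV.
      by exists U => //; have [_ h _] := gX _ _ FU Uu; apply: h => //; apply: VU.
    - by have [_ _ h] := gX _ _ FU Ua; apply: h.
  by left=> x [X FX Xx]; apply: none; exists X; split=> //; exists x.
have max X : good X -> (forall x, Y x -> X x) -> forall x, X x -> Y x.
  move=> gX YX x Xx; apply: boolp.contrapT => nY.
  by apply: (maxY X); [split=> // /(_ x Xx) | right].
have [AY YD YS] : good Y.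
  case: PY => // eY; have gA : good A by split.
  by case: (eY 0); apply: (max A gA) => // x /eY.
have Y1 : ~ Y 1 by move=> /YS.
have Y0 : Y 0 by apply: AY.
have YM a y : Y y -> Y (a * y) by move=> hy; rewrite -[_ * _]addr0; apply: YD.
have YA u v : Y u -> Y v -> Y (u + v) by move=> hu hv; rewrite -[u]mul1r; apply: YD.
have meets u : ~ Y u -> exists y a, Y y /\ S (a * u + y).
  move=> nu; apply: boolp.contrapT => none; apply: nu.
  pose X x := exists y a, Y y /\ x = a * u + y.
  have YX x : Y x -> X x by move=> hx; exists x, 0; split; rewrite // mul0r add0r.
  apply: (max X) => //; last by exists 0, 1; split; rewrite // mul1r addr0.
  split=> [a /AY /YX //|a _ _ [y [b [hy ->]]] [z [c [hz ->]]]|_ [y [b [hy ->]]] hS].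
    exists (a * y + z), (a * b + c); split; first exact: YD.
    by rewrite mulrDr mulrDl mulrA addrACA.
  by apply: none; exists y, b.
have YP u v : Y (u * v) -> Y u \/ Y v.
  move=> huv; apply: boolp.contrapT => /boolp.not_orP[/meets[y [a [hy Sy]]]].
  move=> /meets[z [b [hz Sz]]]; apply: (YS _ _ (SM _ _ Sy Sz)).
  rewrite mulrDl mulrDr [in X in X + _ + _]mulrACA.
  apply: (YA); last by rewrite mulrC; apply: YM.
  by apply: YA; apply: YM.
have [Q hQ] := prime_of_predP Y0 YD Y1 YP.
exists Q; split=> [a /AY /hQ //|s Ss].
by apply/negP => /hQ /YS.
Qed.

Section RegularSequences.
Variables (R : comNzRingType) (M : lmodType R).
Implicit Types (xs : seq R) (m : M).

Lemma in_seqmul0 xs : in_seqmul xs (0 : M).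
Proof. by exists (fun=> 0); rewrite big1 // => j _; rewrite scaler0. Qed.

Lemma in_seqmulP xs a m m' :
  in_seqmul xs m -> in_seqmul xs m' -> in_seqmul xs (a *: m + m').
Proof.
move=> [c ->] [c' ->]; exists (fun j => a *: c j + c' j).
rewrite scaler_sumr -big_split; apply: eq_bigr => j _ /=.
by rewrite scalerDr !scalerA mulrC.
Qed.

Lemma in_seqmul_rcons xs x m :
  in_seqmul (rcons xs x) m <->
  exists u m', in_seqmul xs m' /\ m = x *: u + m'.
Proof.
split=> [[c ->]|[u [_ [[c ->] ->]]]].
  exists (c (size xs)), (\sum_(j < size xs) xs`_j *: c j); split; first by exists c.
  rewrite size_rcons big_ord_recr /= nth_rcons ltnn eqxx addrC; congr (_ + _).
  by apply: eq_bigr => j _; rewrite nth_rcons ltn_ord.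
exists (fun j => if (j < size xs)%N then c j else u).
rewrite size_rcons big_ord_recr /= nth_rcons !ltnn eqxx addrC; congr (_ + _).
by apply: eq_bigr => j _; rewrite nth_rcons ltn_ord.
Qed.

(** One step of the descent: [P] contains the annihilator of [M/(xs, x)M] and
    [x] is regular on [M/xs M]. The products [s * x^j] with [s] outside [P]
    miss the annihilator of [M/xs M], and a prime containing that annihilator
    and missing those products lies strictly below [P], since [x] is in [P]. *)
Lemma prime_below xs x (P : prime_idealr R) :
  (forall m, in_seqmul xs (x *: m) -> in_seqmul xs m) ->
  (forall a, (forall m, in_seqmul (rcons xs x) (a *: m)) -> a \in P) ->
  exists P' : prime_idealr R,
  [/\ forall a, (forall m, in_seqmul xs (a *: m)) -> a \in P',
      {subset P' <= P} & exists2 a, a \in P & a \notin P'].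
Proof.
move=> reg annP.
have regX j m : in_seqmul xs (x ^+ j *: m) -> in_seqmul xs m.
  by elim: j => [|j IH]; rewrite ?scale1r // exprS -scalerA => /reg.
have ann_sub a : (forall m, in_seqmul xs (a *: m)) -> a \in P.
  move=> h; apply: annP => m; apply/in_seqmul_rcons.
  by exists 0, (a *: m); rewrite scaler0 add0r.
pose A a := forall m, in_seqmul xs (a *: m).
pose S b := exists s j, s \notin P /\ b = s * x ^+ j.
have P1 : 1 \notin P by rewrite idealr1.
have [|a u v hu hv m||_ _ [s [i [hs ->]]] [t [j [ht ->]]]||P' [h1 h2]] :=
  @prime_avoiding R A S.
- by move=> m; rewrite scale0r; apply: in_seqmul0.
- by rewrite scalerDl -scalerA; apply: in_seqmulP.
- by exists 1, 0%N; rewrite mul1r.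
- exists (s * t), (i + j)%N; rewrite prime_idealrM negb_or hs ht; split=> //.
  by rewrite mulrACA exprD.
- move=> a ha [s [j [/negP hs e]]]; apply/hs/ann_sub => m.
  by apply: (regX j); rewrite scalerA mulrC -e.
exists P'; split=> // [a|].
  by apply: contraLR => ha; apply: h2; exists a, 0%N; rewrite mulr1.
exists x; last by apply: h2; exists 1, 1%N; rewrite mul1r.
apply: annP => m; apply/in_seqmul_rcons; exists m, 0.
by rewrite addr0; split=> //; apply: in_seqmul0.
Qed.

(** The depth is at most the dimension: starting from a prime above the annihilator
    of [M/xs M], which is a proper ideal, descend one step for each element of
    [xs]. *)
Lemma prime_chain_of_regular xs :
  @regular_seq R M xs -> exists P, @prime_chain R M (size xs) P.
Proof.
move=> [reg [m0 hm0]].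
have [|a u v hu hv m||||P [annP _]] := @prime_avoiding R
    (fun a => forall m : M, in_seqmul xs (a *: m)) (eq 1).
- by move=> m; rewrite scale0r; apply: in_seqmul0.
- by rewrite scalerDl -scalerA; apply: in_seqmulP.
- by [].
- by move=> _ _ <- <-; rewrite mulr1.
- by move=> a ha a1; apply: hm0; rewrite -[m0]scale1r a1.
suff build i (Q : prime_idealr R) : (i <= size xs)%N ->
    (forall a, (forall m : M, in_seqmul (take i xs) (a *: m)) -> a \in Q) ->
    exists P, @prime_chain R M i P /\ P i = Q.
  have [|C [hC _]] := build _ P (leqnn (size xs)); first by rewrite take_size.
  by exists C.
elim: i Q => [|i IH] Q lei annQ.
  exists (fun=> Q); split=> //; split=> // j a _ ha; apply: annQ => m.
  by rewrite ha; apply: in_seqmul0.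
have [m hm|a ha|P' [h1 h2 h3]] := @prime_below (take i xs) xs`_i Q.
- exact: reg hm.
- by apply: annQ => m; rewrite (take_nth 0).
have [C [[c1 c2 c3] Ci]] := IH P' (ltnW lei) h1.
exists (fun j => if (j <= i)%N then C j else Q).
rewrite ltnn; split=> //; split=> [j a lej ha|j ltj|j ltj].
- case: ifP => h; first exact: c1.
  by apply/annQ => m; rewrite ha; apply: in_seqmul0.
- have lej : (j <= i)%N by []; rewrite lej; move: lej; rewrite leq_eqVlt.
  by case/orP => [/eqP ->|lt]; rewrite ?ltnn ?Ci // lt; apply: c2.
- have lej : (j <= i)%N by []; rewrite lej; move: lej; rewrite leq_eqVlt.
  by case/orP => [/eqP ->|lt]; rewrite ?ltnn ?Ci // lt; apply: c3.
Qed.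

End RegularSequences.

(** * Coordinate primes *)

Section CoordinatePrimes.
Variables (k : fieldType) (n : nat).
Local Notation R := {mpoly k[n]}.
Implicit Types (p q : R) (m : 'X_{1..n}) (F G : {set 'I_n}).

Definition mset m : {set 'I_n} := [set i | m i != 0%N].

Definition sqfree F : R := \prod_(i in F) 'X_i.

(** Setting to zero the variables outside [F]; the kernel is the prime ideal
    generated by these variables. *)
Definition restr F : R -> R :=
  comp_mpoly [tuple if i \in F then 'X_i else 0 | i < n].

HB.instance Definition _ F := GRing.LRMorphism.on (restr F).

Definition coord_prime F : pred R := fun p => restr F p == 0.

Lemma mset_mesym1 F : mset (mesym1 F) = F.
Proof. by apply/setP => i; rewrite inE mnmE; case: (i \in F). Qed.

Lemma sqfreeE F : sqfree F = 'X_[mesym1 F].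
Proof.
rewrite [RHS]mpolyXE_id /sqfree big_mkcond /=; apply: eq_bigr => i _.
by rewrite mnmE; case: (i \in F).
Qed.

Lemma restrX F i : restr F 'X_i = if i \in F then 'X_i else 0.
Proof. by rewrite /restr comp_mpolyXU -tnth_nth tnth_mktuple. Qed.

Lemma restrXm F m : restr F 'X_[m] = if mset m \subset F then 'X_[m] else 0.
Proof.
rewrite /restr comp_mpolyX; case: ifP => [/subsetP sub|/negbT/subsetPn[i]].
  rewrite [RHS]mpolyXE_id; apply: eq_bigr => i _; rewrite tnth_mktuple.
  case: ifP => // /negbT iF; have : i \notin mset m by apply: contra iF => /sub.
  by rewrite inE negbK => /eqP ->.
rewrite inE => mi iF; rewrite (bigD1 i) //= tnth_mktuple (negbTE iF).
by rewrite expr0n (negbTE mi) mul0r.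
Qed.

Lemma mcoeff_restr F p m :
  (restr F p)@_m = if mset m \subset F then p@_m else 0.
Proof.
elim/mpolyind: p => [|c m' p _ _ IH]; first by rewrite !raddf0 if_same.
rewrite !raddfD /= linearZ /= !mcoeffZ IH restrXm.
have [->|ne] := eqVneq m' m; first by case: ifP; rewrite ?mcoeff0 ?mulr0 ?addr0.
rewrite (fun_if (mcoeff m)) mcoeffX (negbTE ne) mcoeff0 if_same mulr0 add0r.
by case: ifP; rewrite ?add0r ?addr0.
Qed.

Lemma coord_primeP F p :
  reflect (forall m, mset m \subset F -> p@_m = 0) (coord_prime F p).
Proof.
apply: (iffP eqP) => [e m sub|h].
  by have := mcoeff_restr F p m; rewrite e mcoeff0 sub.
by apply/mpolyP => m; rewrite mcoeff_restr mcoeff0; case: ifP => // /h.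
Qed.

Lemma restr_restr F G p : G \subset F -> restr G (restr F p) = restr G p.
Proof.
move=> GF; apply/mpolyP => m; rewrite !mcoeff_restr.
by case: ifP => // mG; rewrite (subset_trans mG GF).
Qed.

Lemma restr_sqfree F G : restr F (sqfree G) = if G \subset F then sqfree G else 0.
Proof. by rewrite sqfreeE restrXm mset_mesym1. Qed.

Lemma sqfree_neq0 F : sqfree F != 0.
Proof.
rewrite sqfreeE; apply/eqP => e; have := mcoeffX k (mesym1 F) (mesym1 F).
by rewrite e mcoeff0 eqxx => /esym/eqP; rewrite oner_eq0.
Qed.

(** A square-free monomial of degree [#|F|] survives the restriction only if its
    variables are exactly those of [F]. *)
Lemma restr_mesym F : restr F (mesym n k #|F|) = sqfree F.
Proof.
rewrite /mesym raddf_sum (bigD1 F) //= -/(sqfree F) restr_sqfree subxx.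
rewrite big1 ?addr0 // => G /andP[/eqP cG ne].
rewrite -/(sqfree G) restr_sqfree; case: ifP => // GF.
by case/eqP: ne; apply/eqP; rewrite eqEcard GF cG leqnn.
Qed.

Lemma sqfree_dvd F p : (forall m, m \in msupp p -> F \subset mset m) ->
  exists q, p = q * sqfree F.
Proof.
move=> h; exists (\sum_(m <- msupp p) p@_m *: 'X_[m - mesym1 F]).
rewrite {1}[p]mpolyE mulr_suml !big_seq; apply: eq_bigr => m /h /subsetP sub.
rewrite -scalerAl sqfreeE -mpolyXD submK //; apply/mnm_lepP => i.
rewrite mnmE; case: (boolP (i \in F)) => // /sub; rewrite inE.
by rewrite lt0n.
Qed.

Lemma restr_dvdX F i p : i \in F -> coord_prime (F :\ i) p ->
  exists q, restr F p = restr F q * 'X_i.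
Proof.
move=> iF /coord_primeP h; have [m|q e] := @sqfree_dvd [set i] (restr F p).
  rewrite mcoeff_msupp mcoeff_restr sub1set; case: ifP; rewrite ?eqxx // => mF.
  by apply: contraNT => im; apply/eqP/h; rewrite subsetD1 mF.
exists q; rewrite -[LHS](restr_restr _ (subxx F)) e rmorphM /=.
by rewrite restr_sqfree sub1set iF /sqfree big_set1.
Qed.

End CoordinatePrimes.

(** * Filtrations with coordinate quotients of equal dimension *)

Section PureFiltrations.
Variables (k : fieldType) (n : nat) (M : lmodType {mpoly k[n]}).
Local Notation R := {mpoly k[n]}.
Implicit Types (K : M -> Prop) (F : {set 'I_n}).

Definition is_submod K : Prop :=
  K 0 /\ forall a u v, K u -> K v -> K (a *: u + v).

(** Filtrations of [M/K] whose quotients are coordinate rings of dimension [d],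
    recorded by generators in [M] so that no quotient module has to be formed.
    The last index is the length, which is zero only if [M/K] is. *)
Inductive pure_filt (d : nat) : (M -> Prop) -> nat -> Prop :=
| PureNil K : (forall m, K m) -> pure_filt d K 0
| PureCons K K' g F l : #|F| = d ->
    (forall a, K (a *: g) <-> coord_prime F a) ->
    (forall m, K' m <-> exists a u, K u /\ m = a *: g + u) ->
    pure_filt d K' l -> pure_filt d K l.+1.

Lemma is_submodD K u v : is_submod K -> K u -> K v -> K (u + v).
Proof. by move=> [_ h] hu hv; rewrite -[u]scale1r; apply: h. Qed.

Lemma is_submodZ K a u : is_submod K -> K u -> K (a *: u).
Proof. by move=> [h0 h] hu; rewrite -[_ *: _]addr0; apply: h. Qed.

Lemma is_submodB K u v : is_submod K -> K u -> K v -> K (u - v).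
Proof. by move=> hK hu hv; rewrite -scaleN1r addrC; apply: hK.2. Qed.

Lemma is_submod_adjoin K K' g : is_submod K ->
  (forall m, K' m <-> exists a u, K u /\ m = a *: g + u) -> is_submod K'.
Proof.
move=> hK eK'; split=> [|c u v].
  by apply/eK'; exists 0, 0; rewrite scale0r addr0; split=> //; case: hK.
move=> /eK'[a [x [hx ->]]] /eK'[b [y [hy ->]]]; apply/eK'.
exists (c * a + b), (c *: x + y); split; first exact: hK.2.
by rewrite scalerDr scalerDl scalerA addrACA.
Qed.

Lemma pure_filt_ext d K1 K2 l : (forall m, K1 m <-> K2 m) ->
  pure_filt d K1 l -> pure_filt d K2 l.
Proof.
move=> e12 h; case: h e12 => [K h|K K' g F l' cF annF eK' h] e12.
  by apply: PureNil => m; apply/e12.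
apply: (PureCons cF _ _ h) => [a|m]; first by rewrite -e12.
by rewrite eK'; split=> -[a [u [/e12 hu ->]]]; exists a, u.
Qed.

(** The cyclic module with annihilator generated by the prime of [F] and a product
    of distinct variables of [F] is filtered by dropping the factors one at a
    time: in the coordinate ring of [F] the principal ideals of [y] and ['X_f * y]
    have as quotient the coordinate ring of [F] minus [f]. *)
Lemma pure_filt_factors d F (fs : seq 'I_n) K K' g l :
  is_submod K -> #|F| = d.+1 -> uniq fs -> {subset fs <= F} ->
  (forall a, K (a *: g) <->
     exists b, coord_prime F (a - b * \prod_(i <- fs) 'X_i)) ->
  (forall m, K' m <-> exists a u, K u /\ m = a *: g + u) ->
  pure_filt d K' l -> pure_filt d K (size fs + l).
Proof.
move=> hK cF + + annK eK' hK'.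
elim: fs K hK annK eK' => [|f fs IH] K hK annK eK' /= ufs sfs.
  apply: (pure_filt_ext _ hK') => m; rewrite eK'.
  split=> [[a [u [hu ->]]]|hm]; last by exists 0, m; rewrite scale0r add0r.
  apply: is_submodD => //; apply/annK; exists a.
  by rewrite big_nil mulr1 subrr /coord_prime raddf0.
case/andP: ufs => _ ufs; have fF : f \in F by apply: sfs; rewrite inE eqxx.
have {}sfs : {subset fs <= F} by move=> i ifs; apply: sfs; rewrite inE ifs orbT.
set y : R := \prod_(i <- fs) 'X_i.
have y0 : restr F y != 0.
  rewrite rmorph_prod prodf_seq_neq0; apply/allP => i /sfs iF /=.
  rewrite restrX iF; have := sqfree_neq0 k [set i].
  by rewrite /sqfree big_set1.
pose K1 m := exists a u, K u /\ m = a *: (y *: g) + u.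
have eK1 m : K1 m <-> exists a u, K u /\ m = a *: (y *: g) + u by [].
have sK1 := is_submod_adjoin hK eK1.
apply: (@PureCons d _ K1 (y *: g) (F :\ f)) => //.
- by have := cardsD1 f F; rewrite fF cF => -[].
- move=> a; rewrite scalerA annK big_cons -/y; split=> [[b]|/(restr_dvdX fF)[q e]].
    rewrite /coord_prime mulrA -mulrBl rmorphM mulf_eq0 (negbTE y0) orbF => /eqP e.
    rewrite -[restr _ a](restr_restr a (subD1set F f)); move: e.
    rewrite rmorphB /= => /eqP; rewrite subr_eq0 => /eqP ->.
    by rewrite restr_restr ?subD1set // rmorphM /= restrX !inE eqxx mulr0.
  exists q; rewrite /coord_prime mulrA -mulrBl rmorphM rmorphB rmorphM /=.
  by rewrite restrX fF e subrr mul0r.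
apply: (IH K1) => // [a|m].
  split=> [[b [u [hu e]]]|[b hb]].
    have /annK[c] : K ((a - b * y) *: g).
      by rewrite scalerBl e scalerA addrC addKr.
    rewrite big_cons mulrA -/y -addrA -opprD -mulrDl => h.
    by exists (b + c * 'X_f).
  exists b, ((a - b * y) *: g); split; last by rewrite scalerA scalerBl addrC subrK.
  by apply/annK; exists 0; rewrite mul0r subr0.
rewrite eK'; split=> [[a [u [hu ->]]]|[a [_ [[b [u [hu ->]]] ->]]]].
  exists a, u; split=> //; exists 0, u; split=> //.
  by rewrite scale0r add0r.
by exists (a + b * y), u; split=> //; rewrite scalerDl scalerA addrA.
Qed.

(** The elementary symmetric polynomial of degree [d] is nonzero modulo each of the
    coordinate primes of the filtration, hence regular on every quotient. *)
Lemma mesym_regular d K l : is_submod K -> pure_filt d K l ->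
  forall m, K (mesym n k d *: m) -> K m.
Proof.
move=> hK h; elim: h hK => [{}K all|{}K K' g F {}l cF annF eK' _ IH] hK m //.
move=> hm; have hK' := is_submod_adjoin hK eK'.
have /eK'[a [u [hu e]]] : K' m.
  apply: (IH hK'); apply/eK'; exists 0, (mesym n k d *: m).
  by rewrite scale0r add0r.
move: hm; rewrite e scalerDr => hm.
have /annF : K ((mesym n k d * a) *: g).
  have := is_submodB hK hm (is_submodZ (mesym n k d) hK hu).
  by rewrite addrK scalerA.
rewrite /coord_prime rmorphM /= -cF restr_mesym mulf_eq0 (negbTE (sqfree_neq0 _ _)).
by move=> /annF ha; apply: is_submodD.
Qed.

(** On a quotient [R/P] of the filtration, the elementary symmetric polynomial
    acts as the product of the variables outside the coordinate prime [P], so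
    that it is regular and its cokernel is again filtered by coordinate
    quotients, now of dimension one less. *)
Lemma pure_filt_mesym d K l : is_submod K -> pure_filt d.+1 K l ->
  exists2 l', pure_filt d (fun m => exists u v, K v /\ m = mesym n k d.+1 *: u + v) l'
    & (0 < l)%N -> (0 < l')%N.
Proof.
move=> hK h; elim: h hK => [{}K all|{}K K' g F {}l cF annF eK' h IH] hK.
  exists 0%N => //; apply: PureNil => m; exists 0, m.
  by rewrite scaler0 add0r.
have hK' := is_submod_adjoin hK eK'; set e := mesym n k d.+1.
have eF : restr F e = sqfree k F by rewrite /e -cF restr_mesym.
have [l' hl' _] := IH hK'.
exists (size (enum F) + l')%N => [|_]; last by rewrite -cardE cF.
have KK' u : K u -> K' u.
  by move=> hu; apply/eK'; exists 0, u; rewrite scale0r add0r.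
apply: (pure_filt_factors _ cF (enum_uniq _) _ _ _ hl').
- split=> [|a _ _ [u [v [hv ->]]] [u' [v' [hv' ->]]]].
    by exists 0, 0; rewrite scaler0 addr0; split=> //; case: hK.
  exists (a *: u + u'), (a *: v + v'); split; first exact: hK.2.
  by rewrite !scalerDr !scalerA [e * a]mulrC addrACA.
- by move=> i; rewrite mem_enum.
- move=> a; rewrite big_enum /= -/(sqfree k F).
  have eqF b : coord_prime F (a - b * sqfree k F) = coord_prime F (a - b * e).
    by rewrite /coord_prime !rmorphB !rmorphM /= eF restr_sqfree subxx.
  split=> [[u [v [hv E]]]|[b]]; last first.
    rewrite eqF => /annF hb; exists (b *: g), ((a - b * e) *: g); split=> //.
    by rewrite scalerA scalerBl [e * b]mulrC addrC subrK.
  have /eK'[b [w [hw Eu]]] : K' u.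
    apply: (mesym_regular hK' h); apply/eK'; exists a, (- v).
    rewrite E addrK; split=> //.
    by rewrite -scaleN1r; apply: is_submodZ.
  exists b; rewrite eqF; apply/annF; rewrite scalerBl E Eu scalerDr scalerA.
  rewrite [e * b]mulrC -[_ + _ + v]addrA [X in K X]addrC addKr addrC.
  by apply: is_submodD => //; apply: is_submodZ.
- move=> m; split=> [[u [v [/eK'[a [w [hw ->]]] ->]]]|[a [_ [[u [v [hv ->]]] ->]]]].
    exists a, (e *: u + w); split; last by rewrite addrCA.
    by exists u, w.
  exists u, (a *: g + v); split; last by rewrite addrCA.
  by apply/eK'; exists a, v.
Qed.

Lemma pure_filt_proper d K l : pure_filt d K l -> (0 < l)%N -> exists g, ~ K g.
Proof.
case=> // {}K K' g F {}l _ annF _ _ _; exists g; rewrite -[g]scale1r => /annF.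
by rewrite /coord_prime rmorph1 oner_eq0.
Qed.

Lemma in_seqmul_submod xs : is_submod (@in_seqmul R M xs).
Proof. by split; [apply: in_seqmul0 | move=> a u v; apply: in_seqmulP]. Qed.

(** Adjoining the elementary symmetric polynomials of degrees [d], ..., [1] in this
    order lowers the dimension of the filtration by one at each step; it ends with
    a filtration of positive length, so that the final quotient is nonzero. *)
Lemma pure_filt_extend_regular d xs l : (0 < l)%N ->
  pure_filt d (in_seqmul xs) l -> {subset xs <= @irrelevant k n} ->
  (forall i m, (i < size xs)%N -> in_seqmul (take i xs) (xs`_i *: m) ->
     @in_seqmul R M (take i xs) m) ->
  exists ys, [/\ size ys = (size xs + d)%N, {subset ys <= @irrelevant k n}
    & @regular_seq R M ys].
Proof.
elim: d xs l => [|d IH] xs l l0 hl sxs reg.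
  exists xs; rewrite addn0; split=> //; split=> //.
  exact: pure_filt_proper hl l0.
have [l' hl' /(_ l0) l'0] := pure_filt_mesym (in_seqmul_submod xs) hl.
have [||i m|ys [sz sys hys]] := IH (rcons xs (mesym n k d.+1)) l' l'0.
- by apply: (pure_filt_ext _ hl') => m; rewrite in_seqmul_rcons.
- move=> p; rewrite mem_rcons inE => /orP[/eqP ->|]; last exact: sxs.
  rewrite inE mcoeff_mesym mecharP; case: existsP => [[F]|_]; last by rewrite eqxx.
  case/andP=> /eqP e /eqP cF; have : mdeg (mesym1 F) = 0%N by rewrite -e mdeg0.
  by rewrite mdeg_mesym1 cF.
- rewrite size_rcons ltnS leq_eqVlt nth_rcons => /orP[/eqP ->|lt].
    rewrite ltnn eqxx -cats1 take_size_cat //.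
    exact: (mesym_regular (in_seqmul_submod xs) hl).
  by rewrite lt -cats1 takel_cat 1?ltnW //; apply: reg.
by exists ys; split=> //; rewrite sz size_rcons addSnnS.
Qed.

(** A prime containing the annihilator contains the product of the coordinate
    primes of the filtration, hence one of them. *)
Lemma pure_filt_prime d K l (P : prime_idealr R) : pure_filt d K l ->
  (exists2 F : {set 'I_n}, #|F| = d & forall a, coord_prime F a -> a \in P) \/
  (exists2 s, s \notin P & is_submod K -> forall m, K (s *: m)).
Proof.
elim=> [{}K all|{}K K' g F {}l cF annF eK' _ [|[s sP hs]]]; [|by left|].
  by right; exists 1; rewrite ?idealr1.
have [FP|] := boolp.pselect (forall a, coord_prime F a -> a \in P).
  by left; exists F.
move=> /boolp.existsNP[t /boolp.not_implyP[tF /negP tP]]; right; exists (t * s).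
  by rewrite prime_idealrM negb_or tP.
move=> hK m; rewrite -scalerA.
have /eK'[a [u [hu ->]]] := hs (is_submod_adjoin hK eK') m.
rewrite scalerDr scalerA; apply: is_submodD => //; last exact: is_submodZ.
by apply/annF; rewrite /coord_prime rmorphM /= (eqP tF) mul0r.
Qed.

End PureFiltrations.

(** * Krull dimension of coordinate quotients *)

Section KrullDimension.
Variables (k : fieldType) (n : nat).
Local Notation R := {mpoly k[n]}.

Definition deg_le D (p : R) : Prop := forall m, m \in msupp p -> (mdeg m <= D)%N.

Lemma deg_leM D E p q : deg_le D p -> deg_le E q -> deg_le (D + E) (p * q).
Proof.
move=> hp hq m /msuppM_le /allpairsP[[m1 m2] /= [h1 h2 ->]].
by rewrite mdegD leq_add ?hp ?hq.
Qed.

Lemma deg_le1 D : deg_le D 1.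
Proof. by move=> m; rewrite msupp1 inE => /eqP ->; rewrite mdeg0. Qed.

Lemma deg_le_prod (t D N : nat) (a : 'I_t -> R) (e : 'I_t -> nat) :
  (forall i, deg_le D (a i)) -> (forall i, (e i <= N)%N) ->
  deg_le (t * (N * D)) (\prod_(i < t) a i ^+ e i).
Proof.
move=> ha he; rewrite -[X in (X * _)%N]card_ord -sum_nat_const.
apply: (big_ind2 (fun D p => deg_le D p)) => [|D1 p1 D2 p2|i _].
- exact: deg_le1.
- exact: deg_leM.
have hX j : deg_le (j * D) (a i ^+ j).
  elim: j => [|j IH]; first exact: deg_le1.
  by rewrite exprS mulSn; apply: deg_leM.
by move=> m /hX h; rewrite (leq_trans h) ?leq_mul2r ?he ?orbT.
Qed.

(** Counting: the products [\prod_i a_i ^+ e_i] with exponents at most [N]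
    number [N.+1 ^ t], while modulo the coordinate prime they lie in a space of
    dimension polynomial in [N] of degree [#|F|], smaller than [t]. *)
Lemma algebraic_dependence (F : {set 'I_n}) (t : nat) (a : 'I_t -> R) :
  (#|F| < t)%N ->
  exists N (c : {ffun 'I_t -> 'I_N.+1} -> k), (exists e, c e != 0) /\
    coord_prime F (\sum_e (c e)%:MP * \prod_(i < t) a i ^+ e i).
Proof.
move=> ltFt; pose D := (\max_(i < t) \max_(m <- msupp (a i)) mdeg m)%N.
have aD i : deg_le D (a i).
  move=> m hm; rewrite (leq_trans _ (leq_bigmax i)) //.
  by rewrite (big_rem m hm) /= leq_maxl.
(* With this [N] one has
   [(N * (t * D)).+1 ^ #|F| <= N.+1 ^ #|F| * N < N.+1 ^ #|F|.+1 <= N.+1 ^ t]. *)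
pose N := ((t * D).+1 ^ #|F|)%N; exists N.
pose B := (t * (N * D))%N.
pose E := {ffun 'I_t -> 'I_N.+1}.
pose H := {ffun {i : 'I_n | i \in F} -> 'I_B.+1}.
pose mon (h : H) := [multinom if insub i is Some s then h s : nat else 0%N | i < n].
pose prd (e : E) : R := \prod_(i < t) a i ^+ e i.
pose A := \matrix_(i < #|E|, j < #|H|) (prd (enum_val i))@_(mon (enum_val j)).
have lt_card : (#|H| < #|E|)%N.
  rewrite !card_ffun !card_ord card_sig.
  have -> : #|[pred i | i \in F]| = #|F| by apply: eq_card.
  have le1 : (B.+1 <= N.+1 * (t * D).+1)%N.
    by rewrite /B mulnCA ltn_mul.
  have le2 : (N.+1 ^ #|F|.+1 <= N.+1 ^ t)%N by rewrite leq_pexp2l.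
  apply: leq_trans le2; rewrite expnS.
  case: (posnP #|F|) => [->|F0]; first by rewrite !expn0 muln1 ltnS expn_gt0.
  move: le1; rewrite -(leq_exp2r _ _ F0) expnMn => le1.
  by apply: leq_ltn_trans le1 _; rewrite mulnC ltn_pmul2r ?expn_gt0.
have : kermx A != 0.
  by rewrite -mxrank_eq0 mxrank_ker subn_eq0 -ltnNge (leq_ltn_trans (rank_leq_col A)).
case/rowV0Pn => v /sub_kermxP vA v0; exists (fun e => v 0 (enum_rank e)); split.
  have [i vi] : exists i, v 0 i != 0.
    apply/existsP; apply: contraNT v0 => /existsPn h; apply/eqP/rowP => i.
    by rewrite mxE; have := h i; rewrite negbK => /eqP.
  by exists (enum_val i); rewrite enum_valK.
apply/coord_primeP => m mF; rewrite raddf_sum /=.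
have [mB|] := boolP [forall i, (m i <= B)%N]; last first.
  case/forallPn => i; rewrite -ltnNge => miB; apply: big1 => e _.
  rewrite mcoeffCM memN_msupp_eq0 ?mulr0 //; apply/negP => hm.
  have := deg_le_prod aD (fun i => leq_ord (e i)) hm.
  rewrite leqNgt => /negP; apply; apply: (leq_trans miB).
  by rewrite mdegE (bigD1 i) //= leq_addr.
pose h : H := [ffun s => inord (m (val s))].
have hm : mon h = m.
  apply/mnmP => i; rewrite mnmE; case: insubP => [s _ <-|iF].
    by rewrite ffunE inordK // ltnS (forallP mB).
  have : i \notin mset m by apply: contra iF => /(subsetP mF).
  by rewrite inE negbK => /eqP ->.
have := congr1 (fun M : 'rV__ => M 0 (enum_rank h)) vA; rewrite !mxE => {2}<-.
rewrite (reindex_onto enum_val enum_rank) /=; last by move=> e _; rewrite enum_rankK.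
apply: eq_big => [i|i _]; first by rewrite enum_valK eqxx.
by rewrite mcoeffCM enum_valK mxE enum_rankK hm.
Qed.

(** Elements chosen along a chain of primes are algebraically independent modulo
    its first prime: keep, for one variable after the other, only the terms of
    smallest exponent. The power of [a_j] factored out is not in the [j]-th
    prime, and the discarded terms lie in the next one. *)
Lemma prime_chain_independent (t N : nat) (P : nat -> prime_idealr R)
    (a : 'I_t -> R) (c : {ffun 'I_t -> 'I_N.+1} -> k) :
  (forall i, (i < t)%N -> {subset P i <= P i.+1}) ->
  (forall i : 'I_t, a i \in P i.+1) -> (forall i : 'I_t, a i \notin P i) ->
  \sum_e (c e)%:MP * \prod_(i < t) a i ^+ e i \in P 0%N -> forall e, c e = 0.
Proof.
move=> PS aP aNP sum0 e0; apply/eqP; apply: contraT => ce0.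
pose term j (e : {ffun 'I_t -> 'I_N.+1}) : R :=
  (c e)%:MP * \prod_(i < t | (j <= i)%N) a i ^+ e i.
suff main j : (j <= t)%N -> exists S : {set {ffun 'I_t -> 'I_N.+1}},
    [/\ exists e, e \in S, forall e, e \in S -> c e != 0,
        forall e e', e \in S -> e' \in S -> forall i : 'I_t, (i < j)%N -> e i = e' i
      & \sum_(e in S) term j e \in P j].
  have [S [[e eS] cS agree]] := main t (leqnn t).
  have -> : S = [set e].
    apply/setP => e'; rewrite inE; apply/idP/eqP => [e'S|-> //].
    by apply/ffunP => i; apply: agree.
  rewrite big_set1 /term big_pred0 => [|i]; last by rewrite leqNgt ltn_ord.
  rewrite mulr1 => /(idealMr (c e)^-1%:MP).
  by rewrite -mpolyCM mulVf ?cS // mpolyC1 idealr1.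
elim: j => [_|j IH ltj].
  exists [set e | c e != 0]; split=> [|e|//|].
  - by exists e0; rewrite inE.
  - by rewrite inE.
  have <- : \sum_e (c e)%:MP * \prod_(i < t) a i ^+ e i =
            \sum_(e in [set e | c e != 0]) term 0%N e; last by [].
  rewrite [RHS]big_mkcond; apply: eq_bigr => e _; rewrite inE /term.
  by case: eqVneq => // ->; rewrite mpolyC0 mul0r.
have [S [[e1 e1S] cS agree sumS]] := IH (ltnW ltj).
pose J := Ordinal ltj.
have [e2 e2S e2min] := arg_minnP (fun e : {ffun 'I_t -> 'I_N.+1} => e J : nat) e1S.
pose S' := [set e in S | e J == e2 J].
have termE e : term j e = a J ^+ e J * term j.+1 e.
  rewrite /term (bigD1 J) //= mulrCA; congr (_ * (_ * _)).
  by apply: eq_bigl => i; rewrite ltn_neqAle andbC eq_sym.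
have S'S e : e \in S' -> e \in S by rewrite inE => /andP[].
exists S'; split=> [|e /S'S|e e' eS' e'S' i|]; first 2 last.
- rewrite ltnS leq_eqVlt => /orP[/eqP ij|]; last by apply: agree; apply: S'S.
  have -> : i = J by apply: val_inj.
  by move: eS' e'S'; rewrite !inE => /andP[_ /eqP ->] /andP[_ /eqP ->].
- have split_sum : \sum_(e in S) term j e = a J ^+ e2 J *
      (\sum_(e in S') term j.+1 e +
       \sum_(e in S | e \notin S') a J ^+ (e J - e2 J) * term j.+1 e).
    rewrite mulrDr !mulr_sumr (bigID (mem S')) /=; congr (_ + _).
      apply: eq_big => e; first by rewrite inE andbA andbb.
      by case/andP => _; rewrite inE termE => /andP[_ /eqP ->].
    apply: eq_bigr => e /andP[eS _].
    by rewrite termE mulrA -exprD subnKC ?e2min.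
  move: sumS; rewrite split_sum prime_idealrM => /orP[|/(PS _ ltj) h].
    have aX u : a J ^+ u \notin P j.
      elim: u => [|u IHu]; first by rewrite idealr1.
      by rewrite exprS prime_idealrM negb_or (aNP J).
    by rewrite (negbTE (aX _)).
  move: h; rewrite rpredDr //; apply: rpred_sum => e /andP[eS]; rewrite inE eS /= => ne.
  have lt : (e2 J < e J)%N by rewrite ltn_neqAle e2min // andbT eq_sym.
  by rewrite -(subnSK lt) exprSr mulrAC; apply/idealMr/(aP J).
- by exists e2; apply/setIdP.
- exact: cS.
Qed.

(** This is the bound on the Krull dimension of a polynomial ring: elements picked
    along a longer chain would be both dependent and independent modulo the
    coordinate prime. *)
Lemma coord_prime_dim (F : {set 'I_n}) e (P : nat -> prime_idealr R) :
  (forall a, coord_prime F a -> a \in P 0%N) ->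
  (forall i, (i < e)%N -> {subset P i <= P i.+1}) ->
  (forall i, (i < e)%N -> exists2 a, a \in P i.+1 & a \notin P i) ->
  (e <= #|F|)%N.
Proof.
move=> FP PS Pneq; rewrite leqNgt; apply/negP => lt.
have ex (i : 'I_e) : exists a, a \in P i.+1 /\ a \notin P i.
  by have [a ha ha'] := Pneq i (ltn_ord i); exists a.
have [a ha] := boolp.choice ex.
have [N [c [[x /eqP cx] dep]]] := algebraic_dependence a lt.
apply/cx/(prime_chain_independent PS _ _ (FP _ dep)) => i; by have [] := ha i.
Qed.

(** The regular sequence of elementary symmetric polynomials bounds the depth and,
    through the chain of primes that it yields, the dimension from below; chains
    of primes are bounded by [d], and regular sequences by chains of primes. *)
Lemma pure_filt_cohen_macaulay (M : lmodType R) d l : (0 < l)%N ->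
  pure_filt d (fun m : M => m = 0) l ->
  has_krull_dim M d /\ has_depth M (@irrelevant k n) d.
Proof.
move=> l0 hl.
have zero_sub : is_submod (fun m : M => m = 0).
  by split=> // a u v -> ->; rewrite scaler0 addr0.
have dim_le e P : @prime_chain R M e P -> (e <= d)%N.
  move=> [annP PS Pneq]; have [[F <- FP]|[s /negP sP hs]] := pure_filt_prime (P 0%N) hl.
    exact: (coord_prime_dim FP PS Pneq).
  by case: sP; apply: annP => // m; apply: hs.
have [|||ys [sz ys_irr reg]] := @pure_filt_extend_regular k n M d [::] l l0.
- apply: pure_filt_ext hl => m; split=> [->|[c ->]]; first exact: in_seqmul0.
  by rewrite big_ord0.
- by [].
- by [].
have [C hC] := prime_chain_of_regular reg; rewrite sz in hC.
split; split=> //; first by exists C.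
- by exists ys.
- by move=> xs _ /prime_chain_of_regular[C']; apply: dim_le.
Qed.

End KrullDimension.

(** * Shellings *)

Section Shellings.
Variable T : finType.
Implicit Types (A B F G W : {set T}) (S : {set {set T}}) (phi : pred {set T}).

(** [t] gives the position of a facet in the shelling, and [r F] is the smallest
    face of [F] that lies in no earlier facet. *)
Definition shelling phi (t : {set T} -> nat) (r : {set T} -> {set T}) : Prop :=
  [/\ forall F G, phi F -> phi G -> t F = t G -> F = G,
      forall F, phi F -> r F \subset F,
      forall F G, phi F -> phi G -> (t G < t F)%N -> ~~ (r F \subset G)
    & forall F v, phi F -> v \in r F ->
        exists G, [/\ phi G, (t G < t F)%N & F :\ v \subset G]].

Definition before (t : {set T} -> nat) G F : bool :=
  (#|F| < #|G|)%N || (#|F| == #|G|) && (t G < t F)%N.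

Lemma shelling_ext phi psi t r : phi =1 psi -> shelling phi t r -> shelling psi t r.
Proof.
move=> e [h1 h2 h3 h4]; split=> [F G|F|F G|F v]; rewrite -?e.
- exact: h1.
- exact: h2.
- exact: h3.
- by move=> hF /(h4 _ _ hF)[G [hG lt sub]]; exists G; rewrite -e.
Qed.

Section Rearrangement.
Variables (phi : pred {set T}) (t : {set T} -> nat) (r : {set T} -> {set T}).
Hypothesis phi_max : forall F G, phi F -> phi G -> F \subset G -> F = G.
Hypothesis hsh : shelling phi t r.

(** Otherwise [G] would be [F] minus [v], which is not maximal. *)
Lemma adjacent_card F G v : phi F -> phi G -> (t G < t F)%N ->
  F :\ v \subset G -> (#|F| <= #|G|)%N.
Proof.
move=> hF hG lt sub; rewrite leqNgt; apply/negP => ltGF.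
have cF := cardsD1 v F.
have /eqP e : F :\ v == G.
  rewrite eqEcard sub; move: ltGF; rewrite cF.
  by case: (v \in F); rewrite ?add1n ?add0n ?ltnS // => /ltnW.
have := phi_max hG hF; rewrite -{1}e subD1set => /(_ isT) eGF.
by rewrite eGF ltnn in lt.
Qed.

(** Removing a suitable vertex from [G] leads to an earlier facet, at least as
    large, that still contains [r F]; this descent can only end at [F]. *)
Lemma card_contains_restriction F G : phi F -> phi G -> (t F < t G)%N ->
  r F \subset G -> (#|G| <= #|F|)%N.
Proof.
have [inj rsub ra rb] := hsh => hF.
move: {2}(t G) (leqnn (t G)) => N; elim: N G => [|N IH] G leN hG lt sub.
  by have := leq_trans lt leN; rewrite ltn0.
have /subsetPn[v vr vF] := ra _ _ hG hF lt.
have [L [hL ltL subL]] := rb _ _ hG vr.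
have rL : r F \subset L.
  apply: subset_trans subL; rewrite subsetD1 sub /=.
  by apply: contra vF => /(subsetP (rsub _ hF)).
apply: leq_trans (adjacent_card hG hL ltL subL) _.
case: (ltngtP (t L) (t F)) => [ltLF|ltFL|/(inj _ _ hL hF) -> //].
  by have := ra _ _ hF hL ltLF; rewrite rL.
by apply: IH => //; rewrite -ltnS (leq_trans ltL).
Qed.

(** Bjoerner and Wachs: sorting the facets of a shelling by decreasing size gives
    a shelling with the same restriction sets. *)
Lemma rearrangement :
  (forall F G, phi F -> phi G -> before t G F -> ~~ (r F \subset G)) /\
  (forall F v, phi F -> v \in r F ->
     exists G, [/\ phi G, before t G F & F :\ v \subset G]).
Proof.
have [inj rsub ra rb] := hsh; split=> [F G hF hG|F v hF /(rb _ _ hF)[G [hG lt sub]]].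
  case/orP => [lt|/andP[_ lt]]; last exact: ra.
  case: (ltngtP (t G) (t F)) => [||/(inj _ _ hG hF) e]; first exact: ra.
    move=> ltFG; apply/negP => /(card_contains_restriction hF hG ltFG).
    by rewrite leqNgt lt.
  by rewrite e ltnn in lt.
exists G; split=> //; rewrite /before lt andbT orbC -leq_eqVlt.
exact: adjacent_card lt sub.
Qed.

End Rearrangement.

(** * Independence complexes of forests *)

(** Restricting the vertices to [W], instead of replacing the sets of [S] by their
    traces on [W], leaves the forest property of [S] intact in inductions that
    remove vertices. *)
Definition indep S W A : bool :=
  (A \subset W) && [forall F in S, ~~ (F :&: W \subset A)].

(** The forest condition on a bare family of sets, so that it passes to subfamilies
    by definition. *)
Definition leafy S : Prop :=
  forall S', S' \subset S -> S' != set0 -> exists F, F \in S' /\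
    (S' = [set F] \/ exists G, [/\ G \in S', G != F &
       forall F', F' \in S' -> F' != F -> F :&: F' \subset G]).

Lemma indepP S W A :
  reflect (A \subset W /\ forall F, F \in S -> ~ (F :&: W \subset A)) (indep S W A).
Proof.
apply: (iffP andP) => -[h1 h2]; split=> //.
  by move=> F FS; apply/negP; apply: (forall_inP h2).
by apply/forall_inP => F /h2/negP.
Qed.

Lemma maxset_antichain (P : pred {set T}) F G :
  maxset P F -> maxset P G -> F \subset G -> F = G.
Proof. by move=> /maxsetP[_ h] /maxsetP[hG _] sub; rewrite (h G). Qed.

Section FreeVertex.
Variables (S : {set {set T}}) (W F : {set T}) (x : T).
Hypotheses (FS : F \in S) (xF : x \in F) (xW : x \in W).
Hypothesis free : forall F', F' \in S -> F' != F -> x \notin F'.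
Let E := F :&: W.
Let phi := maxset (indep S W).
Let phi1 := maxset (indep S (W :\ x)).
Let phi2 := maxset (indep (S :\ F) (W :\: E)).

Let xE : x \in E. Proof. by rewrite inE xF. Qed.

Lemma indep_with_vertex A : x \in A -> indep S W A = indep S (W :\ x) (A :\ x).
Proof.
move=> xA; apply/indepP/indepP => -[sAW h]; split.
- exact: setSD.
- move=> F' F'S sub; apply: (h F' F'S); apply/subsetP => y /setIP[yF yW].
  have [-> //|yx] := eqVneq y x.
  by have := subsetP sub y; rewrite !inE yx yF yW => /(_ isT).
- by rewrite -(setD1K xA) -(setD1K xW); apply: setUS.
- move=> F' F'S sub; apply: (h F' F'S); rewrite setIDA.
  exact: setSD.
Qed.

Lemma indep_without_vertex A : x \notin A -> E :\ x \subset A ->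
  indep S W A = indep (S :\ F) (W :\: E) (A :\: E).
Proof.
move=> xA ZA; apply/indepP/indepP => -[sAW h]; split.
- exact: setSD.
- move=> F' /setD1P[F'F F'S] sub; apply: (h F' F'S); apply/subsetP => y /setIP[yF yW].
  have [yE|yE] := boolP (y \in E); last first.
    have := subsetP sub y; rewrite !in_setD in_setI yE yF in_setD yE yW.
    by move=> /(_ isT) /andP[].
  apply: (subsetP ZA); rewrite !inE in yE *; rewrite yE andbT.
  by apply: contraNneq (free F'S F'F) => <-.
- apply/subsetP => y yA; have [|yE] := boolP (y \in E); first by case/setIP.
  by have /(subsetP sAW) : y \in A :\: E by [rewrite inE yE]; case/setDP.
- move=> F' F'S sub; have [e|ne] := eqVneq F' F.
    by case/negP: xA; apply: (subsetP sub); rewrite e.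
  apply: (h F'); first by rewrite !inE ne.
  by rewrite setIDA; apply: setSD.
Qed.

Lemma facet_with_vertex A : x \in A -> phi A = phi1 (A :\ x).
Proof.
move=> xA; apply/maxsetP/maxsetP => -[hA max]; split.
- by rewrite -indep_with_vertex.
- move=> B hB sub; have [BW _] := indepP _ _ _ hB.
  have xB : x \notin B by apply/negP => /(subsetP BW); rewrite !inE eqxx.
  rewrite -(max (x |: B)) ?setU1K //.
    by rewrite indep_with_vertex ?setU11 // setU1K.
  by rewrite -(setD1K xA); apply: setUS.
- by rewrite indep_with_vertex.
- move=> B hB sub; have xB := subsetP sub _ xA.
  rewrite -(setD1K xA) -(setD1K xB); congr (_ |: _); apply: max; last exact: setSD.
  by rewrite -indep_with_vertex.
Qed.

Lemma facet_without_vertex A : x \notin A ->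
  phi A = (E :\ x \subset A) && phi2 (A :\: E).
Proof.
move=> xA; apply/idP/andP => [/maxsetP[hA max]|[ZA /maxsetP[hA max]]].
  have [AW ind] := indepP _ _ _ hA.
  have ZA : E :\ x \subset A.
    have: ~~ indep S W (x |: A).
      by apply/negP => /max; rewrite subsetUr => /(_ isT) e; rewrite -e setU11 in xA.
    rewrite negb_and subUset sub1set xW AW /= => /forall_inPn[F' F'S].
    rewrite negbK => sub; have [e|ne] := eqVneq F' F.
      by rewrite /E -e subDset.
    case: (ind F' F'S); apply/subsetP => y hy; have := subsetP sub y hy.
    rewrite !inE => /orP[/eqP e|//]; move: hy; rewrite e inE.
    by rewrite (negbTE (free F'S ne)).
  split=> //; apply/maxsetP; split; first by rewrite -indep_without_vertex.
  move=> B hB sub; have [BW _] := indepP _ _ _ hB.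
  have BE y : y \in B -> y \notin E by move=> /(subsetP BW) /setDP[].
  have eB : ((E :\ x) :|: B) :\: E = B.
    apply/setP => y; rewrite in_setD in_setU in_setD1.
    case: (boolP (y \in B)) => [/BE -> |_]; rewrite ?orbT //.
    by rewrite orbF andbCA andNb andbF.
  have xB : x \notin (E :\ x) :|: B.
    by rewrite in_setU setD11; apply/negP => /BE; rewrite xE.
  rewrite -(max ((E :\ x) :|: B)) ?eB //.
    by rewrite indep_without_vertex ?subsetUl // eB.
  apply/subsetP => y yA; rewrite in_setU in_setD1.
  have [yE|yE] := boolP (y \in E); last by rewrite (subsetP sub) ?orbT // inE yE.
  by rewrite andbT; apply/orP; left; apply: contraNneq xA => <-.
apply/maxsetP; split; first by rewrite indep_without_vertex.
move=> B hB sub; have [BW ind] := indepP _ _ _ hB.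
have ZB := subset_trans ZA sub.
have xB : x \notin B.
  apply/negP => xB; apply: (ind F FS); rewrite -/E -(setD1K xE) subUset sub1set xB.
  exact: ZB.
have eB : B :\: E = A :\: E.
  by apply: max; [rewrite -indep_without_vertex | apply: setSD].
apply/eqP; rewrite eqEsubset sub andbT; apply/subsetP => y yB.
have [yE|yE] := boolP (y \in E).
  by apply: (subsetP ZA); rewrite !in_setD1 yE andbT; apply: contraNneq xB => <-.
by have : y \in B :\: E; [rewrite inE yE | rewrite eB => /setDP[]].
Qed.

(** A facet avoiding the free vertex [x] contains the rest of the only non-face
    [E] through [x], and exchanging a vertex of [E] for [x] keeps it independent.
    So the facets through [x], shelled first, meet each later facet in faces
    obtained by deleting one vertex of [E]. *)
Lemma shelling_free_vertex t1 r1 t2 r2 :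
  shelling phi1 t1 r1 -> shelling phi2 t2 r2 -> exists t r, shelling phi t r.
Proof.
move=> [inj1 sub1 a1 b1] [inj2 sub2 a2 b2].
(* The offset puts all facets through [x] before the others. *)
pose K := (\max_(A : {set T}) t1 A).+1.
have t1K A : (t1 A < K)%N by rewrite ltnS (leq_bigmax A).
pose t A := if x \in A then t1 (A :\ x) else (K + t2 (A :\: E))%N.
pose r A := if x \in A then r1 (A :\ x) else (E :\ x) :|: r2 (A :\: E).
have tin A : x \in A -> t A = t1 (A :\ x) by rewrite /t => ->.
have tout A : x \notin A -> t A = (K + t2 (A :\: E))%N by rewrite /t => /negbTE ->.
have rin A : x \in A -> r A = r1 (A :\ x) by rewrite /r => ->.
have rout A : x \notin A -> r A = (E :\ x) :|: r2 (A :\: E).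
  by rewrite /r => /negbTE ->.
have Kout A B : x \in A -> x \notin B -> (t A < t B)%N.
  by move=> xA xB; rewrite tin // tout // ltn_addr.
exists t, r; split.
- move=> F1 F2 h1 h2; have [x1|x1] := boolP (x \in F1); last first.
    have [x2|x2] := boolP (x \in F2).
      by move=> e; have := Kout _ _ x2 x1; rewrite e ltnn.
    move: h1 h2; rewrite !facet_without_vertex // !tout // => /andP[Z1 h1] /andP[Z2 h2].
    move=> /addnI /(inj2 _ _ h1 h2) e.
    have split_set A : x \notin A -> E :\ x \subset A -> A = (E :\ x) :|: (A :\: E).
      move=> xA ZA; apply/setP => y; rewrite in_setU in_setD1 in_setD.
      have [yE|yE] := boolP (y \in E); rewrite ?andbT ?andbF ?orbF //=.
      have [->|yx] := eqVneq y x; first by rewrite (negbTE xA).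
      by rewrite (subsetP ZA) // in_setD1 yx.
    by rewrite (split_set _ x1 Z1) (split_set _ x2 Z2) e.
  have [x2|x2] := boolP (x \in F2); last first.
    by move=> e; have := Kout _ _ x1 x2; rewrite e ltnn.
  rewrite !tin // => /inj1 e; move: h1 h2; rewrite !facet_with_vertex // => h1 h2.
  by rewrite -(setD1K x1) -(setD1K x2) e.
- move=> A; have [xA|xA] := boolP (x \in A).
    rewrite facet_with_vertex // rin // => /sub1 h.
    exact: subset_trans h (subD1set _ _).
  rewrite facet_without_vertex // rout // => /andP[ZA /sub2 h].
  by rewrite subUset ZA (subset_trans h) ?subsetDl.
- move=> A G hA hG; have [xA|xA] := boolP (x \in A).
    have [xG|xG] := boolP (x \in G); last by rewrite ltnNge ltnW // Kout.
    move: hA hG; rewrite !facet_with_vertex // !tin // rin // => hA hG lt.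
    have := a1 _ _ hA hG lt; apply: contra => sub; rewrite subsetD1 sub.
    by apply/negP => /(subsetP (sub1 _ hA)); rewrite setD11.
  rewrite rout // subUset negb_and.
  have [xG _|xG] := boolP (x \in G).
    apply/orP; left; apply/negP => ZG.
    have /maxsetP[/indepP[_ ind] _] := hG; apply: (ind F FS).
    by rewrite -/E -(setD1K xE) subUset sub1set xG.
  move: hA hG; rewrite !facet_without_vertex // !tout // ltn_add2l.
  move=> /andP[_ hA] /andP[_ hG] lt; apply/orP; right.
  have := a2 _ _ hA hG lt; apply: contra => sub; apply/subsetP => y yr.
  rewrite inE (subsetP sub) // andbT.
  by have /(subsetP (sub2 _ hA)) /setDP[] := yr.
move=> A v; have [xA|xA] := boolP (x \in A).
  rewrite facet_with_vertex // rin // => hA vr.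
  have [G [hG lt sub]] := b1 _ _ hA vr.
  have xG : x \notin G.
    apply/negP => xG; have /maxsetP[/indepP[GW _] _] := hG.
    by have := subsetP GW _ xG; rewrite setD11.
  exists (x |: G); rewrite facet_with_vertex ?setU11 // setU1K // !tin ?setU11 //.
  rewrite setU1K //; split=> //; apply/subsetP => y; rewrite !inE => /andP[yv yA].
  have [//|yx] := eqVneq y x.
  by apply: (subsetP sub); rewrite !inE yv yx.
move=> hA; rewrite rout //; case/setUP => [vZ|vr]; last first.
  move: (hA); rewrite facet_without_vertex // => /andP[ZA h2].
  have [G [hG lt sub]] := b2 _ _ h2 vr.
  have GE y : y \in G -> y \notin E.
    move=> yG; have /maxsetP[/indepP[GW _] _] := hG.
    by have /setDP[] := subsetP GW _ yG.
  have xG : x \notin (E :\ x) :|: G.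
    by rewrite in_setU setD11; apply/negP => /GE; rewrite xE.
  have eG : ((E :\ x) :|: G) :\: E = G.
    apply/setP => y; rewrite in_setD in_setU in_setD1.
    case: (boolP (y \in G)) => [/GE -> |_]; rewrite ?orbT //.
    by rewrite orbF andbCA andNb andbF.
  exists ((E :\ x) :|: G); rewrite facet_without_vertex // subsetUl eG !tout // eG.
  rewrite ltn_add2l; split=> //; apply/subsetP => y; rewrite in_setD1 => /andP[yv yA].
  rewrite in_setU in_setD1; have [yE|yE] := boolP (y \in E).
    by rewrite andbT; apply/orP; left; apply: contraNneq xA => <-.
  by apply/orP; right; apply: (subsetP sub); rewrite in_setD1 in_setD yv yE.
have /maxsetP[/indepP[AW ind] _] := hA.
have vE : v \in E by case/setD1P: vZ.
have vx : v != x by case/setD1P: vZ.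
have hx : indep S W (x |: (A :\ v)).
  apply/indepP; split.
    by rewrite subUset sub1set xW (subset_trans (subD1set _ _)).
  move=> F' F'S sub; have [e|ne] := eqVneq F' F.
    have := subsetP sub v; rewrite e => /(_ vE).
    by rewrite !inE eqxx (negbTE vx).
  apply: (ind F' F'S); apply/subsetP => y hy; have := subsetP sub y hy.
  rewrite !inE => /orP[/eqP e|/andP[] //]; move: hy; rewrite e inE.
  by rewrite (negbTE (free F'S ne)).
have [G hG sub] := maxset_exists hx.
have xG : x \in G by apply: (subsetP sub); rewrite setU11.
exists G; split=> //; first exact: Kout.
exact: subset_trans (subsetUr _ _) sub.
Qed.

End FreeVertex.

Lemma leafyS S S' : S' \subset S -> leafy S -> leafy S'.
Proof. by move=> sub h S'' sub'; apply: h; apply: subset_trans sub' sub. Qed.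

(** Take a leaf [F] with joint [G]. If the trace of [F] lies in [G], every set
    containing the trace of [G] contains that of [F], and [G] can be dropped.
    Otherwise a vertex of the trace of [F] outside [G] lies in no other set. *)
Lemma leafy_shelling S W : leafy S -> exists t r, shelling (maxset (indep S W)) t r.
Proof.
have empty W' : exists t r, shelling (maxset (indep set0 W')) t r.
  exists (fun=> 0%N), (fun=> set0); have max A : maxset (indep set0 W') A -> A = W'.
    case/maxsetP => /indepP[AW _] /(_ W') -> //; apply/indepP; split=> // F.
    by rewrite inE.
  by split=> // [A B /max -> /max -> //|A _|A v _]; rewrite ?sub0set ?inE.
move: {2}(#|S| + #|W|)%N (leqnn (#|S| + #|W|)) => N.
elim: N S W => [|N IH] S W leN leafS; have [->|] := eqVneq S set0; try exact: empty.
  by rewrite -cards_eq0 -leqn0 (leq_trans (leq_addr _ _) leN).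
have drop F G : F \in S -> G \in S -> G != F -> F :&: W \subset G ->
    exists t r, shelling (maxset (indep S W)) t r.
  move=> FS GS GF sub; have [||t [r h]] := IH (S :\ G) W.
  - by move: leN; rewrite (cardsD1 G) GS.
  - by apply: leafyS leafS; apply: subD1set.
  exists t, r; apply: shelling_ext h => A; apply: maxset_eq => B.
  apply/indepP/indepP => -[BW ind]; split=> // F' F'S; last first.
    by apply: ind; case/setD1P: F'S.
  have [-> GB|ne] := eqVneq F' G; last by apply: ind; rewrite !inE ne.
  apply: (ind F); first by rewrite !inE eq_sym GF.
  by apply: subset_trans GB; rewrite subsetI sub subsetIr.
case/(leafS _ (subxx S)) => F [FS leaf].
have free x : x \in F -> x \in W ->
    (forall F', F' \in S -> F' != F -> x \notin F') ->
    exists t r, shelling (maxset (indep S W)) t r.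
  move=> xF xW hx; have [||t1 [r1 h1]] := IH S (W :\ x) => //.
    by move: leN; rewrite (cardsD1 x W) xW addnCA.
  have [||t2 [r2 h2]] := IH (S :\ F) (W :\: (F :&: W)).
  - move: leN; rewrite (cardsD1 F S) FS add1n addSn ltnS; apply: leq_trans.
    by rewrite leq_add2l subset_leq_card // subsetDl.
  - by apply: leafyS leafS; apply: subD1set.
  exact: (shelling_free_vertex FS xF xW hx h1 h2).
case: leaf => [S1|[G [GS GF joint]]].
  have [E0|/set0Pn[x /setIP[xF xW]]] := eqVneq (F :&: W) set0; last first.
    by apply: (free x) => // F'; rewrite S1 inE => ->.
  have none A : maxset (indep S W) A = false.
    apply/negP => /maxsetP[/indepP[_ /(_ F FS)]]; rewrite E0 sub0set; case=> //.
  by exists (fun=> 0%N), (fun=> set0); split=> [A B|A|A B|A v]; rewrite none.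
have [|/subsetPn[x /setIP[xF xW] xG]] := boolP (F :&: W \subset G).
  exact: drop.
apply: (free x) => // F' F'S ne; apply: contra xG => xF'.
by apply: (subsetP (joint _ F'S ne)); rewrite inE xF.
Qed.

End Shellings.

(** * The filtration of the facet quotient *)

Section LayerFiltration.
Variables (k : fieldType) (n : nat).
Local Notation R := {mpoly k[n]}.
Variables (phi : pred {set 'I_n}) (t : {set 'I_n} -> nat).
Variable r : {set 'I_n} -> {set 'I_n}.
Hypothesis t_inj : forall F G, phi F -> phi G -> t F = t G -> F = G.
Hypothesis r_sub : forall F, phi F -> r F \subset F.
Hypothesis r_new : forall F G, phi F -> phi G -> before t G F -> ~~ (r F \subset G).
Hypothesis r_min : forall F v, phi F -> v \in r F ->
  exists G, [/\ phi G, before t G F & F :\ v \subset G].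

Definition vanishes (psi : pred {set 'I_n}) (p : R) : Prop :=
  forall F, psi F -> coord_prime F p.

Lemma coord_primeD F (a p q : R) :
  coord_prime F p -> coord_prime F q -> coord_prime F (a * p + q).
Proof.
rewrite /coord_prime rmorphD rmorphM /= => /eqP -> /eqP ->.
by rewrite mulr0 addr0.
Qed.

Lemma vanishesD psi (a p q : R) :
  vanishes psi p -> vanishes psi q -> vanishes psi (a * p + q).
Proof. by move=> hp hq F hF; apply: coord_primeD; [apply: hp | apply: hq]. Qed.

Lemma vanishes0 psi : vanishes psi 0.
Proof. by move=> F _; rewrite /coord_prime raddf0. Qed.

(** The monomials vanishing on the facets before [F] but not on [F] are those
    whose support is a face of [F] containing [r F]. So the square-free monomial
    of [r F] generates a module isomorphic to the coordinate ring of [F]. *)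
Lemma restr_new_face F p : phi F -> vanishes (fun G => phi G && before t G F) p ->
  exists q, restr F p = q * sqfree k (r F).
Proof.
move=> hF hp; apply: sqfree_dvd => m; rewrite mcoeff_msupp mcoeff_restr.
case: ifP => [mF|]; last by rewrite eqxx.
apply: contraR => /subsetPn[v vr vm]; have [G [hG lt sub]] := r_min hF vr.
have /coord_primeP -> // : coord_prime G p by apply: hp; rewrite hG.
by apply: subset_trans sub; rewrite subsetD1 mF.
Qed.

(** The map [theta] presents [M] as [B0/B1]. Going through the facets of size [d]
    in the order of [t], each imposes one more vanishing condition, and the
    condition imposed by [F] cuts out a quotient generated by the image of the
    square-free monomial of [r F] and isomorphic to the coordinate ring of
    [F]. *)
Lemma layer_pure_filt (d : nat) (M : lmodType R) (theta : R -> M) :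
  let B0 := vanishes (fun F => phi F && (d < #|F|)%N) in
  let B1 := vanishes (fun F => phi F && (d <= #|F|)%N) in
  (forall a p q, B0 p -> B0 q -> theta (a * p + q) = a *: theta p + theta q) ->
  (forall p, B0 p -> (theta p = 0 <-> B1 p)) ->
  (forall m, exists p, B0 p /\ m = theta p) ->
  (exists2 F, phi F & #|F| = d) ->
  exists2 l, (0 < l)%N & pure_filt d (fun m : M => m = 0) l.
Proof.
move=> B0 B1 lin ker surj [F0 hF0 cF0].
have B00 : B0 0 by apply: vanishes0.
have th0 : theta 0 = 0 by apply/ker => //; apply: vanishes0.
have linZ a p : B0 p -> theta (a * p) = a *: theta p.
  by move=> hp; rewrite -[a * p]addr0 lin // th0 addr0.
pose B j := vanishes (fun F => phi F && ((d < #|F|)%N || (#|F| == d) && (t F < j)%N)).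
pose K j m := exists p, B j p /\ m = theta p.
have BB0 j p : B j p -> B0 p.
  by move=> hp F /andP[hF lt]; apply: hp; rewrite hF lt.
have BS j p : B j.+1 p <->
    B j p /\ forall F, phi F -> #|F| = d -> t F = j -> coord_prime F p.
  split=> [hp|[hp hpj] F /andP[hF]]; first split=> F.
  - case/andP=> hF h; apply: hp; rewrite hF /=.
    by case/orP: h => [-> //|/andP[-> lt]]; rewrite ltnS (ltnW lt) orbT.
  - by move=> hF cF tF; apply: hp; rewrite hF cF tF eqxx ltnSn orbT.
  case/orP=> [lt|/andP[/eqP cF]]; first by apply: hp; rewrite hF lt.
  rewrite ltnS leq_eqVlt => /orP[/eqP tF|lt]; first exact: hpj.
  by apply: hp; rewrite hF cF eqxx lt orbT.
suff build j : exists2 l, pure_filt d (K j) l &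
    forall F, phi F -> #|F| = d -> (t F < j)%N -> (0 < l)%N.
  have [l hl l0] := build (\max_(F : {set 'I_n}) t F).+1.
  have tmax F : (t F < (\max_(F : {set 'I_n}) t F).+1)%N by rewrite ltnS (leq_bigmax F).
  exists l; first exact: (l0 F0).
  apply: pure_filt_ext hl => m; split=> [[p [hp ->]]|->]; last first.
    by exists 0; split=> //; apply: vanishes0.
  apply/ker; first exact: BB0 hp.
  move=> F /andP[hF]; rewrite leq_eqVlt => /orP[/eqP cF|lt]; apply: hp; rewrite hF.
    by rewrite cF eqxx tmax orbT.
  by rewrite lt.
elim: j => [|j [l hl l0]].
  exists 0%N => // ; apply: PureNil => m; have [p [hp ->]] := surj m.
  exists p; split=> // F /andP[hF]; rewrite ltn0 andbF orbF => lt.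
  by apply: hp; rewrite hF.
have [[F [hF cF tF]]|none] := boolp.pselect (exists F, [/\ phi F, #|F| = d & t F = j]);
  last first.
  exists l => [|F hF cF]; last first.
    rewrite ltnS leq_eqVlt => /orP[/eqP tF|]; last exact: l0.
    by case: none; exists F.
  apply: pure_filt_ext hl => m; split=> -[p [hp ->]]; exists p; split=> //.
    by apply/BS; split=> // F hF cF tF; case: none; exists F.
  by have /BS[] := hp.
exists l.+1 => //.
have beforeE G : phi G -> before t G F = (d < #|G|)%N || (#|G| == d) && (t G < j)%N.
  by move=> hG; rewrite /before cF tF eq_sym.
have BF p : B j p <-> vanishes (fun G => phi G && before t G F) p.
  by split=> hp G /andP[hG h]; apply: hp; rewrite hG ?beforeE // -beforeE.
set x := sqfree k (r F).
have Bx : B j x.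
  apply/BF => G /andP[hG lt]; rewrite /coord_prime restr_sqfree.
  by rewrite (negbTE (r_new hF hG lt)).
have restr_x : restr F x = x by rewrite restr_sqfree r_sub.
have Bax a : B j (a * x).
  by rewrite -[a * x]addr0; apply: vanishesD => //; apply: vanishes0.
have BSF p : B j.+1 p <-> B j p /\ coord_prime F p.
  rewrite BS; split=> -[h1 h2]; split=> //; first exact: h2.
  move=> G hG cG tG; by rewrite (t_inj hG hF) // tG.
apply: (PureCons cF _ _ hl (g := theta x)) => [a|m].
  rewrite -linZ; last exact: BB0 Bx.
  have ax : coord_prime F (a * x) = coord_prime F a.
    by rewrite /coord_prime rmorphM /= restr_x mulf_eq0 (negbTE (sqfree_neq0 _ _)) orbF.
  split=> [[p [/BSF[hp pF] e]]|aF]; last first.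
    by exists (a * x); split=> //; apply/BSF; split; rewrite ?ax.
  rewrite -ax -[a * x](subrK p) -[_ - p]mul1r; apply: coord_primeD => //.
  have hd : B0 (a * x - p).
    rewrite -[p]mul1r -mulNr addrC.
    by apply: vanishesD; [exact: BB0 hp | exact: BB0 (Bax a)].
  have /ker B1d : theta (a * x - p) = 0.
    rewrite -[p]mul1r -mulNr addrC lin; [|exact: BB0 hp|exact: BB0 (Bax a)].
    by rewrite scaleN1r e addNr.
  by apply: B1d => //; rewrite hF cF leqnn.
split=> [[p [hp ->]]|[a [_ [[p [/BSF[hp _] ->]] ->]]]]; last first.
  exists (a * x + p); split; first exact: vanishesD.
  by rewrite lin; [| exact: BB0 Bx | exact: BB0 hp].
have [a e] := restr_new_face hF (proj1 (BF p) hp).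
exists a, (theta (p - a * x)); split; last first.
  rewrite -lin; [by rewrite addrC subrK | exact: BB0 Bx |].
  by rewrite -mulNr addrC; apply: vanishesD; [exact: BB0 Bx | exact: BB0 hp].
exists (p - a * x); split=> //; apply/BSF; split.
  by rewrite -mulNr addrC; apply: vanishesD.
rewrite /coord_prime rmorphB /= -[X in X - _](restr_restr _ (subxx F)) e.
by rewrite subrr.
Qed.

End LayerFiltration.

Section VanishingSubmodules.
Variables (k : fieldType) (n : nat).
Local Notation R := {mpoly k[n]}.
Variables (I : submodClosed R^o) (phi : pred {set 'I_n}).
Hypothesis I_vanishes : forall p : R, p \in I <-> vanishes phi p.
Implicit Types psi : pred {set 'I_n}.
Local Notation pi := (@quotmod_pi R R^o I).

Definition vanishing psi : {pred quotmod I} :=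
  fun u => boolp.asbool (exists p : R, u = pi p /\ vanishes psi p).

Fact vanishing_closed psi : submod_closed (vanishing psi).
Proof.
split=> [|a _ _ /boolp.asboolP[p [-> hp]] /boolp.asboolP[q [-> hq]]].
  by apply/boolp.asboolP; exists 0; rewrite linear0; split=> //; apply: vanishes0.
apply/boolp.asboolP; exists (a * p + q); split; last exact: vanishesD.
by rewrite -linearP.
Qed.

HB.instance Definition _ psi :=
  GRing.isSubmodClosed.Build R (quotmod I) (vanishing psi) (vanishing_closed psi).

Lemma vanishingP psi (p : R) : (forall F, psi F -> phi F) ->
  pi p \in vanishing psi <-> vanishes psi p.
Proof.
move=> psi_phi; split=> [/boolp.asboolP[q [/eqP]]|hp]; last first.
  by apply/boolp.asboolP; exists p.
rewrite quotmod_pi_eq => /I_vanishes hpq hq F hF.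
rewrite -(subrK q p) -[p - q]mul1r; apply: coord_primeD; last exact: hq.
exact/hpq/psi_phi.
Qed.

Lemma vanishingS psi1 psi2 : (forall F, psi2 F -> psi1 F) ->
  {subset vanishing psi1 <= vanishing psi2}.
Proof.
move=> sub u /boolp.asboolP[p [-> hp]]; apply/boolp.asboolP.
by exists p; split=> // F /sub /hp.
Qed.

(** Presents the layer between two vanishing submodules by polynomials, so that it
    can be studied without representatives of nested quotients. *)
Lemma subquot_param psi1 psi2 :
  (forall F, psi2 F -> psi1 F) -> (forall F, psi1 F -> phi F) ->
  exists theta : R -> subquot (vanishing psi2) (vanishing psi1),
  [/\ forall a p q, vanishes psi2 p -> vanishes psi2 q ->
        theta (a * p + q) = a *: theta p + theta q,
      forall p, vanishes psi2 p -> (theta p = 0 <-> vanishes psi1 p)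
    & forall m, exists p, vanishes psi2 p /\ m = theta p].
Proof.
move=> psi21 psi1_phi; have psi2_phi F : psi2 F -> phi F by move=> /psi21/psi1_phi.
pose lift (p : R) : submod (vanishing psi2) := insubd 0 (pi p).
have liftE p : vanishes psi2 p -> val (lift p) = pi p.
  by move=> hp; apply: insubdK; apply/vanishingP.
exists (fun p => quotmod_pi (submod_pred (vanishing psi1)) (lift p)).
split=> [a p q hp hq|p hp|m].
- rewrite -linearP; congr quotmod_pi; apply: val_inj.
  rewrite linearP /= !liftE //; last exact: vanishesD.
  by rewrite -linearP.
- rewrite -(vanishingP _ psi1_phi) -liftE //.
  by split=> [/eqP|h]; [|apply/eqP]; rewrite quotmod_pi_eq0.
- have [u ->] := quotmod_piP m; have /boolp.asboolP[p [e hp]] := valP u.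
  exists p; split=> //; congr quotmod_pi; apply: val_inj.
  by rewrite liftE.
Qed.

End VanishingSubmodules.

Lemma coord_prime_pihomog (k : fieldType) n (F : {set 'I_n}) i (p : {mpoly k[n]}) :
  coord_prime F p -> coord_prime F (pihomog mdeg i p).
Proof.
move=> /coord_primeP h; apply/coord_primeP => m mF.
rewrite pihomogE raddf_sum big1 //= => m' _; rewrite mcoeffZ mcoeffX.
by have [->|_] := eqVneq m' m; rewrite ?mulr0 // h ?mul0r.
Qed.

Section Facets.
Variables (k : fieldType) (n : nat) (D : complex 'I_n).
Local Notation R := {mpoly k[n]}.

Lemma facetP F G : F \in facets D -> G \in faces D -> F \subset G -> F = G.
Proof. by rewrite inE => /maxsetP[_ h] hG sub; rewrite (h G). Qed.

Lemma facet_face F : F \in facets D -> F \in faces D.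
Proof. by rewrite inE => /maxsetP[]. Qed.

Lemma facet_neq0 F : F \in facets D -> F != set0.
Proof.
move=> hF; have /set0Pn[v hv] := vertices_neq0 D.
apply/eqP => F0; have := facetP hF (face_vertex hv); rewrite F0 sub0set => /(_ isT).
by move/setP/(_ v); rewrite !inE eqxx.
Qed.

(** A nonempty set of facets is the set of facets of the complex that it
    generates, so the forest property bears on all families of facets. *)
Lemma forest_leafy : simplicial_forest D -> leafy (facets D).
Proof.
move=> forest S sub /set0Pn[F0 F0S].
pose fc := [set F : {set 'I_n} | [exists G in S, F \subset G]].
have fcP (F : {set 'I_n}) : reflect (exists2 G, G \in S & F \subset G) (F \in fc).
  by rewrite inE; apply: (iffP exists_inP).
have V0 : cover S != set0.
  have /set0Pn[v hv] := facet_neq0 (subsetP sub _ F0S).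
  by apply/set0Pn; exists v; apply/bigcupP; exists F0.
have Fsub (F : {set 'I_n}) : F \in fc -> F \subset cover S.
  by case/fcP => G GS FG; apply: subset_trans FG (bigcup_sup G GS).
have Fdown (F G : {set 'I_n}) : F \in fc -> G \subset F -> G \in fc.
  case/fcP => H HS FH GF; apply/fcP; exists H => //; exact: subset_trans GF FH.
have Fvert v : v \in cover S -> [set v] \in fc.
  by case/bigcupP => G GS vG; apply/fcP; exists G; rewrite ?sub1set.
pose E := Complex V0 Fsub Fdown Fvert.
have eE : facets E = S.
  apply/setP => F; rewrite inE; apply/maxsetP/idP => [[/fcP[G GS FG] max]|FS].
    by rewrite -(max G) //; apply/fcP; exists G.
  split=> [|G /fcP[H HS GH] FG]; first by apply/fcP; exists F.
  have FH : F = H.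
    apply: facetP; rewrite ?(subsetP sub) ?facet_face ?(subsetP sub) //.
    exact: subset_trans FG GH.
  by apply/eqP; rewrite eqEsubset FG FH GH.
have subE : subcollection E D by rewrite /subcollection eE.
by have [F [hF leaf]] := forest E subE; exists F; rewrite -eE.
Qed.

Let phi : pred {set 'I_n} := maxset (indep (facets D) setT).

(** Both ideals are spanned by monomials: a monomial is outside the facet ideal iff
    its support contains no facet, iff its support extends to a maximal independent
    set, iff it is nonzero modulo some coordinate prime. *)
Lemma facet_idealP (p : R) : p \in facet_ideal k D <-> vanishes phi p.
Proof.
pose s := @facet_gens k n D.
have genE g : g \in s <-> exists2 F, F \in facets D & g = sqfree k F.
  split=> [/mapP[F]|[F hF ->]]; first by rewrite mem_enum => hF ->; exists F.
  by apply/mapP; exists F; rewrite ?mem_enum.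
have mem_gen a F : F \in facets D -> a * sqfree k F \in facet_ideal k D.
  move=> hF; have gs : sqfree k F \in s by apply/genE; exists F.
  have lt : (index (sqfree k F) s < size s)%N by rewrite index_mem.
  apply/ideal_genP; exists (fun j => if j == index (sqfree k F) s then a else 0).
  rewrite (bigD1 (Ordinal lt)) //= eqxx nth_index // big1 ?addr0 // => j.
  by rewrite -val_eqE /= => /negbTE ->; rewrite mul0r.
split=> [/ideal_genP[a ->] G /maxsetP[/indepP[_ ind] _]|hp].
  rewrite /coord_prime raddf_sum big1 //= => j _.
  have /genE[F hF ->] : s`_j \in s by apply: mem_nth.
  rewrite rmorphM /= restr_sqfree; case: ifP => [FG|]; last by rewrite mulr0.
  by case: (ind F hF); rewrite setIT.
rewrite [p]mpolyE big_seq; apply: (@rpred_sum R^o (facet_ideal k D)) => m hm.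
have : ~~ indep (facets D) setT (mset m).
  apply/negP => /maxset_exists[G hG mG]; move: hm.
  by rewrite mcoeff_msupp (coord_primeP _ _ (hp _ hG)) ?eqxx.
rewrite negb_and subsetT /= => /forall_inPn[F hF]; rewrite negbK setIT => Fm.
have [m'|q ->] := @sqfree_dvd k n F (p@_m *: 'X_[m]); last exact: mem_gen.
rewrite mcoeff_msupp mcoeffZ mcoeffX; case: (eqVneq m m') => [<- //|_].
by rewrite mulr0 eqxx.
Qed.

Lemma graded_vanishing (psi : pred {set 'I_n}) : (forall F, psi F -> phi F) ->
  @graded_submod k n (facet_quotient k D) (@vanishing k n (facet_ideal k D) psi).
Proof.
move=> psi_phi s c us hc.
have ex d : exists x : R^o, poly_comp d x /\ c d = quotmod_pi (facet_ideal k D) x.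
  by have [x hx e] := hc d; exists x.
have [y hy] := boolp.choice ex.
have -> : \sum_(d <- s) c d = quotmod_pi (facet_ideal k D) (\sum_(d <- s) y d).
  by rewrite linear_sum; apply: eq_bigr => d _; rewrite (hy d).2.
move=> /(vanishingP facet_idealP _ psi_phi) hs d ds.
rewrite (hy d).2; apply/(vanishingP facet_idealP _ psi_phi) => F hF.
apply: (@poly_indep k n (@coord_prime k n F) _ _ s y us) => // [|i p|e|].
- by rewrite unfold_in /coord_prime raddf0.
- exact: coord_prime_pihomog.
- by have [] := hy e.
- exact: hs.
Qed.

End Facets.

Lemma has_krull_dim_unique (R : comNzRingType) (M : lmodType R) d e :
  has_krull_dim M d -> has_krull_dim M e -> d = e.
Proof.
move=> [[P hP] led] [[Q hQ] lee]; apply/eqP.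
by rewrite eqn_leq (lee _ _ hP) (led _ _ hQ).
Qed.

Theorem corollary5p6 (k : fieldType) (n : nat) (D : complex 'I_n)
  (hD : simplicial_tree D \/ simplicial_forest D) :
  sequentially_CM (facet_quotient k D).
Proof.
have leaf : leafy (facets D) by apply: forest_leafy; case: hD => [[]|].
have [t [r sh]] := leafy_shelling setT leaf.
pose phi : pred {set 'I_n} := maxset (indep (facets D) setT).
have phi_max F G : phi F -> phi G -> F \subset G -> F = G.
  exact: maxset_antichain.
have [r_new r_min] := rearrangement phi_max sh.
have [t_inj r_sub _ _] := sh.
pose ds : seq nat := [seq d <- iota 0 n.+1 |
  [exists F : {set 'I_n}, phi F && (#|F| == d)]].
have ds_uniq : uniq ds by rewrite filter_uniq ?iota_uniq.
have ds_sorted : sorted ltn ds.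
  by rewrite sorted_filter ?iota_ltn_sorted //; apply: ltn_trans.
have phi_ds F : phi F -> #|F| \in ds.
  move=> hF; rewrite mem_filter mem_iota add0n ltnS.
  have := max_card (mem F); rewrite card_ord => ->; rewrite !andbT.
  by apply/existsP; exists F; rewrite hF eqxx.
have ds_phi d : d \in ds -> exists2 F, phi F & #|F| = d.
  by rewrite mem_filter => /andP[/existsP[F /andP[hF /eqP cF]] _]; exists F.
have index_lt : {in ds &, forall d e, (index d ds < index e ds)%N = (d < e)%N}.
  have imp : {in ds &, forall d e, (index d ds < index e ds)%N -> (d < e)%N}.
    by move=> d e hd he /(sorted_ltn_index ltn_trans ds_sorted _ _ hd he).
  move=> d e hd he; apply/idP/idP; first exact: imp.
  apply: contraTT; rewrite -!leqNgt leq_eqVlt => /orP[/eqP h|/(imp _ _ he hd)/ltnW //].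
  by rewrite -(nth_index 0%N hd) -(nth_index 0%N he) h.
(* The [i]-th submodule forgets the facets of the [i] smallest sizes; the facets
   forgotten at step [i] all have the [i]-th size. *)
pose psi i : pred {set 'I_n} := fun F => phi F && (i <= index #|F| ds)%N.
have psi_phi i F : psi i F -> phi F by case/andP.
have psiS i F : psi i.+1 F -> psi i F.
  by case/andP => hF lt; rewrite /psi hF ltnW.
have layer i : (i < size ds)%N ->
    let M := subquot (vanishing (I := facet_ideal k D) (psi i.+1))
                     (vanishing (psi i)) in
    has_krull_dim M (nth 0%N ds i) /\ has_depth M (@irrelevant k n) (nth 0%N ds i).
  move=> lti M; set d := nth 0%N ds i.
  have d_ds : d \in ds by apply: mem_nth.
  have id : index d ds = i by apply: index_uniq.
  have eq_gt F : psi i.+1 F = phi F && (d < #|F|)%N.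
    by rewrite /psi; case hF: (phi F) => //=; rewrite -(index_lt d) ?phi_ds // id.
  have eq_ge F : psi i F = phi F && (d <= #|F|)%N.
    rewrite /psi; case hF: (phi F) => //=.
    by rewrite [RHS]leqNgt -(index_lt _ d) ?phi_ds // id -leqNgt.
  have [theta [lin ker surj]] :=
    subquot_param (@facet_idealP k n D) (psiS i) (psi_phi i).
  have gtE p : vanishes (psi i.+1) p <-> vanishes (fun F => phi F && (d < #|F|)%N) p.
    by split=> h F; [rewrite -eq_gt | rewrite eq_gt] => /h.
  have geE p : vanishes (psi i) p <-> vanishes (fun F => phi F && (d <= #|F|)%N) p.
    by split=> h F; [rewrite -eq_ge | rewrite eq_ge] => /h.
  have [||||l l0 hl] :=
    layer_pure_filt t_inj r_sub r_new r_min (d := d) (theta := theta).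
  - by move=> a p q /gtE hp /gtE hq; apply: lin.
  - by move=> p /gtE hp; rewrite -geE; apply: ker.
  - by move=> m; have [p [/gtE hp ->]] := surj m; exists p.
  - exact: ds_phi.
  exact: pure_filt_cohen_macaulay l0 hl.
exists (size ds), (fun i =>
  vanishing (psi i) : submodClosed (quotmod (facet_ideal k D))); split.
- split=> u; have [p ->] := quotmod_piP u.
    rewrite [RHS]quotmod_pi_eq0; apply/idP/idP.
      move=> /(vanishingP (@facet_idealP k n D) _ (psi_phi 0%N)) h.
      by apply/facet_idealP => F hF; apply: h; rewrite /psi leq0n andbT.
    move=> /facet_idealP h; apply/(vanishingP (@facet_idealP k n D) _ (psi_phi 0%N)).
    by move=> F /andP[/h].
  rewrite [RHS]inE; apply/(vanishingP (@facet_idealP k n D) _ (psi_phi _)) => F.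
  by case/andP => /phi_ds; rewrite -index_mem ltnNge => /negbTE ->.
- by move=> i _; apply: graded_vanishing; apply: psi_phi.
- by move=> i _; apply: vanishingS; apply: psiS.
- by move=> i lti; exists (nth 0%N ds i); apply: layer.
- move=> i d e lti hd he; have [hd' _] := layer i (ltnW lti).
  have [he' _] := layer i.+1 lti.
  rewrite (has_krull_dim_unique hd hd') (has_krull_dim_unique he he').
  exact: (sorted_ltn_nth ltn_trans 0%N ds_sorted i i.+1 (ltnW lti) lti (ltnSn i)).
Qed.
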